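(* Let $n\ge 2$ be an integer, let $\sigma\in SL(n,\mathbb{Z})$ be hyperbolic, regarded as an automorphism of the torus $\mathbb{T}^n\cong\mathbb{R}^n/\mathbb{Z}^n$, let $\hat\sigma$ be the induced automorphism of the Pontryagin dual $\widehat{\mathbb{T}^n}\cong\mathbb{Z}^n$, and let $\Gamma=\mathbb{Z}^n\rtimes_{\hat\sigma}\mathbb{Z}$. Let $(H,\Delta)$ be the compact quantum group $H=C^*(\Gamma)$ with $\Delta(\gamma)=\gamma\otimes\gamma$ for $\gamma\in\Gamma$. Then for every nonzero unital $C^*$-algebra $A$ and every free coaction $\delta:A\to A\otimes H$ of $(H,\Delta)$, there does not exist a $(\Delta,\delta_\Delta)$-equivariant unital $*$-homomorphism $H\to A\circledast_\delta H$.
   Context: A matrix $\sigma\in SL(n,\mathbb{Z})$ is hyperbolic if none of its (complex) eigenvalues has absolute value $1$. The dual automorphism is $\hat\sigma(\chi)=\chi\circ\sigma$ for characters $\chi$ of $\mathbb{T}^n$. In $\mathbb{Z}^n\rtimes_{\hat\sigma}\mathbb{Z}$ the generator of $\mathbb{Z}$ acts on $\mathbb{Z}^n$ by $\hat\sigma$. This group is amenable, so its full and reduced group $C^*$-algebras coincide. $\otimes$ denotes the minimal tensor product of $C^*$-algebras. A coaction of a compact quantum group $(H,\Delta)$ on a unital $C^*$-algebra $A$ is an injective unital $*$-homomorphism $\delta:A\to A\otimes H$ with $(\delta\otimes\mathrm{id})\circ\delta=(\mathrm{id}\otimes\Delta)\circ\delta$ and with the linear span of $\delta(A)(1\otimes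 H)$ dense in $A\otimes H$. It is free if the set of finite sums $\sum_i (a_i \otimes 1)\delta(b_i)$, with $a_i, b_i \in A$, is dense in $A \otimes H$. The equivariant noncommutative join of $A$ and $H$ is $$A \circledast_\delta H = \{f \in \mathcal{C}([0,1], A\otimes H) : f(0)\in \mathbb{C} \otimes H,\ f(1)\in \delta(A)\}.$$ It carries a coaction $\delta_\Delta$ of $(H,\Delta)$ given by applying $\mathrm{id}_A\otimes\Delta$ at each $t\in[0,1]$. For $C^*$-algebras $A,B$ with coactions $\delta_A,\delta_B$ of $(H,\Delta)$, a $*$-homomorphism $\phi:A\to B$ is $(\delta_A,\delta_B)$-equivariant if $\delta_B\circ\phi=(\phi\otimes\mathrm{id}_H)\circ\delta_A$. *)

(* Defs.v *)
From HB Require Import structures.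
From mathcomp Require Import all_boot all_order all_algebra.
From mathcomp Require Import boolp classical_sets reals topology normedtype.
From mathcomp Require Import sequences trigo.
From mathcomp Require Import complex sesquilinear.
Set Implicit Arguments.
Unset Strict Implicit.
Unset Printing Implicit Defensive.
Import Order.TTheory GRing.Theory Num.Theory.
Import numFieldNormedType.Exports.
Local Open Scope classical_set_scope.
Local Open Scope ring_scope.

(* Nonzero unital C*-algebras over R[i]: nonzero because of [cs_one_neq0].
   This is a record rather than an HB structure because a join of a ring
   structure with a normed module over other scalars is refused by
   Hierarchy-Builder (it clashes with [Num.NumDomain]); the library structures
   are put on the carrier below. The norm takes its values in R[i]. *)
Record cstarType (R : realType) := CStar {
  cs_mod : completeNormedModType R[i];
  cs_one : cs_mod;
  cs_mul : cs_mod -> cs_mod -> cs_mod;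
  cs_star : cs_mod -> cs_mod;
  cs_mulA : associative cs_mul;
  cs_mul1 : left_id cs_one cs_mul;
  cs_mulr1 : right_id cs_one cs_mul;
  cs_mulDl : left_distributive cs_mul +%R;
  cs_mulDr : right_distributive cs_mul +%R;
  cs_one_neq0 : cs_one != 0;
  cs_scaleAl : forall (c : R[i]) x y, c *: cs_mul x y = cs_mul (c *: x) y;
  cs_scaleAr : forall (c : R[i]) x y, c *: cs_mul x y = cs_mul x (c *: y);
  cs_starD : {morph cs_star : x y / x + y};
  cs_starZ : forall (c : R[i]) x, cs_star (c *: x) = Num.conj c *: cs_star x;
  cs_starM : forall x y, cs_star (cs_mul x y) = cs_mul (cs_star y) (cs_star x);
  cs_starK : involutive cs_star;
  cs_normM : forall x y, `|cs_mul x y| <= `|x| * `|y|;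
  cs_norm_star : forall x, `|cs_mul (cs_star x) x| = `|x| ^+ 2
}.

Definition cs_sort (R : realType) (A : cstarType R) : Type := cs_mod A.
Coercion cs_sort : cstarType >-> Sortclass.

Section CStarAlgebra.
Variables (R : realType) (A : cstarType R).
HB.instance Definition _ := CompleteNormedModule.copy (cs_sort A) (cs_mod A).
HB.instance Definition _ := GRing.Zmodule_isNzRing.Build (cs_sort A)
  (@cs_mulA R A) (@cs_mul1 R A) (@cs_mulr1 R A) (@cs_mulDl R A) (@cs_mulDr R A)
  (@cs_one_neq0 R A).
HB.instance Definition _ := GRing.Lmodule_isLalgebra.Build R[i] (cs_sort A)
  (@cs_scaleAl R A).
HB.instance Definition _ := GRing.Lalgebra_isAlgebra.Build R[i] (cs_sort A)
  (@cs_scaleAr R A).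

Definition star (x : A) : A := cs_star x.
Lemma starD : {morph star : x y / x + y}. Proof. exact: cs_starD. Qed.
Lemma starZ (c : R[i]) (x : A) : star (c *: x) = Num.conj c *: star x.
Proof. exact: cs_starZ. Qed.
Lemma starM (x y : A) : star (x * y) = star y * star x.
Proof. exact: cs_starM. Qed.
Lemma starK : involutive star. Proof. exact: cs_starK. Qed.
Lemma cstar_normM (x y : A) : `|x * y| <= `|x| * `|y|.
Proof. exact: cs_normM. Qed.
Lemma cstar_norm_star (x : A) : `|star x * x| = `|x| ^+ 2.
Proof. exact: cs_norm_star. Qed.
End CStarAlgebra.

Record starHom (R : realType) (A B : cstarType R) := StarHom {
  starHom_fun :> {lrmorphism A -> B};
  starHom_star : forall x, starHom_fun (star x) = star (starHom_fun x)
}.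

(* A contractive multiplicative *-linear relation with dense domain extends to
   a unital *-homomorphism. *)
Section Extension.
Variables (R : realType) (T T' : cstarType R) (D : T -> T' -> Prop).
Hypothesis D1 : D 1 1.
Hypothesis Dlin : forall (c : R[i]) x x' y y',
  D x x' -> D y y' -> D (c *: x + y) (c *: x' + y').
Hypothesis DM : forall x x' y y', D x x' -> D y y' -> D (x * y) (x' * y').
Hypothesis Dstar : forall x x', D x x' -> D (star x) (star x').
Hypothesis Dnorm : forall x x', D x x' -> `|x'| <= `|x|.
Hypothesis Ddense : closure [set x | exists x', D x x'] = setT.

Let P x y := forall e : R[i], 0 < e ->
  exists u v, [/\ D u v, `|x - u| < e & `|y - v| < e].

Let PD u v : D u v -> P u v.
Proof. by move=> Duv e e0; exists u, v; rewrite !subrr !normr0. Qed.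

Let Plin (c : R[i]) x x' y y' :
  P x x' -> P y y' -> P (c *: x + y) (c *: x' + y').
Proof.
move=> Px Py e e0; have c1 : 0 < `|c| + 1 by rewrite ltr_wpDl.
have e1 : 0 < e / (`|c| + 1) by rewrite divr_gt0.
have bound (V : cstarType R) (a b s t : V) : `|a - s| < e / (`|c| + 1) ->
    `|b - t| < e / (`|c| + 1) -> `|c *: a + b - (c *: s + t)| < e.
  move=> las lbt; rewrite opprD addrACA -scalerBr.
  apply: (le_lt_trans (ler_normD _ _)); rewrite normrZ.
  rewrite [X in _ < X](_ : e = `|c| * (e / (`|c| + 1)) + e / (`|c| + 1)); last first.
    by rewrite -{2}[e / _]mul1r -mulrDl mulrCA divff ?mulr1 ?gt_eqF.
  by rewrite ler_ltD// ler_wpM2l// ltW.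
have [u [v [Duv xu x'v]]] := Px _ e1; have [s [t [Dst ys y't]]] := Py _ e1.
by exists (c *: u + s), (c *: v + t); split; [exact: Dlin|exact: bound..].
Qed.

Let PM x x' y y' : P x x' -> P y y' -> P (x * y) (x' * y').
Proof.
move=> Px Py e e0.
pose m := `|x| + `|y| + 1 + (`|x'| + `|y'| + 1 + e); pose d := e / m.
have n0 (V : cstarType R) (a b : V) : 0 <= `|a| + `|b| + 1 by rewrite !addr_ge0.
have mx : `|x| + `|y| + 1 < m by rewrite /m ltrDl ltr_wpDl.
have mx' : `|x'| + `|y'| + 1 < m by rewrite /m addrCA ltrDl ltr_wpDl.
have m0 : 0 < m by apply: le_lt_trans mx.
have d0 : 0 < d by rewrite divr_gt0.
have d1 : d < 1.
  by rewrite ltr_pdivrMr// mul1r /m addrA ltrDr ltr_wpDl// ltr_wpDl ?addr_ge0.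
have bound (V : cstarType R) (a b s t : V) : `|a| + `|b| + 1 < m ->
    `|a - s| < d -> `|b - t| < d -> `|a * b - s * t| < e.
  move=> mab las lbt.
  have -> : a * b - s * t = a * (b - t) + (a - s) * t.
    by rewrite mulrBr mulrBl addrA subrK.
  have lt : `|t| <= `|b| + 1.
    rewrite -[t](subKr b) (le_trans (ler_normB _ _))// lerD2l.
    by rewrite (le_trans (ltW lbt))// ltW.
  apply: (@le_lt_trans _ _ ((`|a| + `|b| + 1) * d)).
    rewrite (le_trans (ler_normD _ _))// -(addrA `|a|) (mulrDl `|a|). rewrite lerD//.
      by rewrite (le_trans (cstar_normM _ _))// ler_wpM2l// ltW.
    rewrite (le_trans (cstar_normM _ _))// mulrC.
    by rewrite ler_pM// ltW.
  have md : m * d <= e by rewrite mulrC divfK ?gt_eqF.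
  by apply: lt_le_trans md; rewrite ltr_pM2r.
have [u [v [Duv xu x'v]]] := Px _ d0; have [s [t [Dst ys y't]]] := Py _ d0.
by exists (u * s), (v * t); split; [exact: DM|exact: bound..].
Qed.

Lemma cstar_norm_starE (V : cstarType R) (x : V) : `|star x| = `|x|.
Proof.
suff le (y : V) : `|y| <= `|star y|.
  by apply/eqP; rewrite eq_le le andbT -{2}[x]starK le.
have [->|y0] := eqVneq y 0; first by rewrite normr0.
rewrite -(@ler_pM2r _ `|y|) ?normr_gt0// -expr2 -cstar_norm_star.
exact: cstar_normM.
Qed.

Let Pstar x x' : P x x' -> P (star x) (star x').
Proof.
have starB (V : cstarType R) (a b : V) : star a - star b = star (a - b).
  by rewrite -[- b in RHS]scaleN1r starD starZ rmorphN1 scaleN1r.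
move=> Px e e0; have [u [v [Duv xu x'v]]] := Px _ e0.
exists (star u), (star v); rewrite !starB !cstar_norm_starE; split => //.
exact: Dstar.
Qed.

Let Pnorm x x' : P x x' -> `|x'| <= `|x|.
Proof.
move=> Px; apply/ler_addgt0Pr => e e0.
have e2 : 0 < e / 2 by rewrite divr_gt0.
have [u [v [Duv xu x'v]]] := Px _ e2.
rewrite -[x'](subrK v) (le_trans (ler_normD _ _))//.
apply: (le_trans (lerD (ltW x'v) (Dnorm Duv))).
rewrite [X in _ <= _ + X]splitr addrA [leLHS]addrC lerD2r.
rewrite -[u](subrK x) [u - x + x]addrC (le_trans (ler_normD _ _))// lerD2l distrC.
exact: ltW.
Qed.

Let Pfun x y z : P x y -> P x z -> y = z.
Proof.
move=> Py Pz; have := Pnorm (Plin (-1) Py Pz).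
by rewrite !scaleN1r addNr normr0 normr_le0 addrC subr_eq0 => /eqP.
Qed.

Let Ptot x : exists y, P x y.
Proof.
have apx (e : R[i]) : 0 < e -> exists u v, D u v /\ `|x - u| < e.
  move=> e0; have : closure [set x | exists x', D x x'] x by rewrite Ddense.
  move=> /(_ (ball x e) (nbhsx_ballx _ _ e0)) [u [[v Duv]]].
  by rewrite -ball_normE => xu; exists u, v.
have /choice[w Hw] (n : nat) : exists w : T * T',
    D w.1 w.2 /\ `|x - w.1| < (n.+1%:R)^-1.
  by have [|u [v uv]] := apx (n.+1%:R)^-1; [rewrite invr_gt0|exists (u, v)].
have Hc (n : nat) m : (n <= m)%N -> `|x - (w m).1| < (n.+1%:R)^-1.
  move=> nm; apply: (lt_le_trans (Hw m).2).
  by rewrite lef_pV2 ?posrE// ler_nat.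
have archi (e : R[i]) : 0 < e -> exists n : nat, (n.+1%:R)^-1 < e.
  case: e => r i; rewrite ltcE /= => /andP[/eqP -> r0].
  exists (Num.truncn r^-1).
  have -> : (Num.truncn r^-1).+1%:R = ((Num.truncn r^-1).+1%:R : R)%:C%C.
    by rewrite rmorph_nat.
  rewrite -[Complex r 0]/(r%:C%C) -fmorphV ltcR invf_plt ?posrE//.
  exact: truncnS_gt.
have w2cauchy : cauchy ((fun n => (w n).2) @ \oo).
  apply/cauchyP => e e0; have [|n ne] := archi (e / 2).
    by rewrite divr_gt0.
  exists (w n).2, n => // m /= nm; rewrite -ball_normE /=.
  have := Dnorm (Dlin (-1) (Hw m).1 (Hw n).1).
  rewrite !scaleN1r ![- _ + _]addrC => /le_lt_trans; apply.
  rewrite -(subrK x (w n).1) -addrA (le_lt_trans (ler_normD _ _))//.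
  rewrite [ltRHS]splitr ltrD//.
    by rewrite distrC; apply: lt_trans ne; exact: Hc.
  by apply: lt_trans ne; exact: Hc.
have /cauchy_cvgP /cvg_ex[y wy] := w2cauchy.
exists y => e e0; have [n ne] := archi e e0.
move/cvgrPdist_lt : wy => /(_ e e0)[m _ Hm].
exists (w (maxn n m)).1, (w (maxn n m)).2; split.
- exact: (Hw _).1.
- by apply: lt_trans ne; apply: Hc; exact: leq_maxl.
- by apply: Hm; exact: leq_maxr.
Qed.
Lemma starHom_extension :
  exists F : starHom T T', forall x x', D x x' -> F x = x'.
Proof.
pose f x := projT1 (cid (Ptot x)).
have fP x : P x (f x) := projT2 (cid (Ptot x)).
have f_lin : linear f.
  by move=> c x y; apply: Pfun (fP _) _; exact: Plin.
have f_mon : monoid_morphism f.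
  split; first by apply: Pfun (fP _) _; exact: PD.
  by move=> x y; apply: Pfun (fP _) _; exact: PM.
pose fL := GRing.isLinear.Build R[i] T T' _ f f_lin.
pose fM := GRing.isMonoidMorphism.Build T T' f f_mon.
pose F : {lrmorphism T -> T'} := HB.pack f fL fM.
have F_star x : F (star x) = star (F x).
  by apply: Pfun (fP _) _; exact: Pstar.
exists (StarHom F_star) => x x' Dxx'.
by apply: Pfun (fP _) _; exact: PD.
Qed.
End Extension.

(* [hdot] is linear in its first argument. *)
Record hilbertType (R : realType) := Hilbert {
  hilbert_sort :> completeNormedModType R[i];
  hdot : {dot hilbert_sort for Num.conj};
  hdotE : forall x, hdot x x = `|x| ^+ 2
}.

(* Unital *-representations on a Hilbert space. *)
Record starRep (R : realType) (A : cstarType R) (K : hilbertType R) := StarRep {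
  rep_fun :> A -> {linear K -> K};
  rep_bounded : forall a, exists M : R[i], forall x, `|rep_fun a x| <= M * `|x|;
  rep_linear : forall x, linear (fun a => rep_fun a x);
  rep_one : forall x, rep_fun 1 x = x;
  repM : forall a b x, rep_fun (a * b) x = rep_fun a (rep_fun b x);
  rep_star : forall a x y,
    hdot K (rep_fun a x) y = hdot K x (rep_fun (star a) y)
}.

Section Tensor.
Variable R : realType.

(* A list of pairs stands for the sum of the corresponding simple tensors in the
   algebraic tensor product. [hsq eta] is the squared norm of eta in the Hilbert
   tensor product of K and L. *)
Definition hsq (K L : hilbertType R) (eta : seq (K * L)) : R[i] :=
  \sum_(u <- eta) \sum_(v <- eta) hdot K u.1 v.1 * hdot L u.2 v.2.

(* The operator (p \otimes q)(s) on the Hilbert tensor product of K and L has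
   norm at most M; by density it suffices to test algebraic tensors. *)
Definition spatial_le (A B : cstarType R) (K L : hilbertType R)
    (p : starRep A K) (q : starRep B L) (s : seq (A * B)) (M : R[i]) : Prop :=
  forall eta : seq (K * L),
    hsq [seq (p x.1 u.1, q x.2 u.2) | x <- s, u <- eta] <= M ^+ 2 * hsq eta.

(* The minimal tensor product, i.e. the completion of the algebraic tensor
   product for ||s||_min = sup_(p, q) ||(p \otimes q)(s)||, p and q ranging over
   the unital *-representations of A and B. It is given up to isomorphism, with
   [tinl a] = a \otimes 1 and [tinr b] = 1 \otimes b; [tnorm] says that the norm
   is this supremum. *)
Record minTensor (A B : cstarType R) := MinTensor {
  tens :> cstarType R;
  tinl : starHom A tens;
  tinr : starHom B tens;
  tcomm : forall a b, tinl a * tinr b = tinr b * tinl a;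
  tdense : closure [set x | exists s : seq (A * B),
             x = \sum_(p <- s) tinl p.1 * tinr p.2] = setT;
  tnorm : forall (s : seq (A * B)) (M : R[i]), 0 <= M ->
    (`|\sum_(p <- s) tinl p.1 * tinr p.2| <= M <->
     forall (K L : hilbertType R) (p : starRep A K) (q : starRep B L),
       spatial_le p q s M)
}.
End Tensor.

Section TensorMap.
Variable R : realType.

Program Definition rep_comp (A A' : cstarType R) (f : starHom A A')
    (K : hilbertType R) (p : starRep A' K) : starRep A K :=
  @StarRep R A K (fun a => p (f a)) _ _ _ _ _.
Next Obligation. by move=> A A' f K p a; exact: rep_bounded. Qed.
Next Obligation.
by move=> A A' f K p x c a b /=; rewrite linearP; exact: (rep_linear p).
Qed.
Next Obligation. by move=> A A' f K p x /=; rewrite rmorph1 rep_one. Qed.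
Next Obligation. by move=> A A' f K p a b x /=; rewrite rmorphM repM. Qed.
Next Obligation. by move=> A A' f K p a x y /=; rewrite starHom_star rep_star. Qed.

Variables (A A' B B' : cstarType R) (T : minTensor A B) (T' : minTensor A' B').
Variables (f : starHom A A') (g : starHom B B').

Let elt (s : seq (A * B)) : T := \sum_(p <- s) tinl T p.1 * tinr T p.2.
Let elt' (s : seq (A * B)) : T' :=
  \sum_(p <- s) tinl T' (f p.1) * tinr T' (g p.2).

Let D (x : T) (x' : T') := exists2 s, x = elt s & x' = elt' s.

Let D1 : D 1 1.
Proof.
by exists [:: (1, 1)]; rewrite /elt /elt' big_seq1 !rmorph1 mulr1.
Qed.

Let Dlin (c : R[i]) x x' y y' :
  D x x' -> D y y' -> D (c *: x + y) (c *: x' + y').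
Proof.
move=> [s -> ->] [t -> ->]; exists ([seq (c *: p.1, p.2) | p <- s] ++ t).
  rewrite /elt big_cat big_map scaler_sumr; congr (_ + _).
  by apply: eq_bigr => p _; rewrite linearZ scalerAl.
rewrite /elt' big_cat big_map scaler_sumr; congr (_ + _).
by apply: eq_bigr => p _; rewrite !linearZ scalerAl.
Qed.

Let DM x x' y y' : D x x' -> D y y' -> D (x * y) (x' * y').
Proof.
move=> [s -> ->] [t -> ->].
exists [seq (p.1 * q.1, p.2 * q.2) | p <- s, q <- t].
  rewrite /elt big_allpairs_dep mulr_suml; apply: eq_bigr => p _.
  rewrite mulr_sumr; apply: eq_bigr => q _.
  by rewrite !rmorphM -!mulrA; congr (_ * _); rewrite !mulrA tcomm.
rewrite /elt' big_allpairs_dep mulr_suml; apply: eq_bigr => p _.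
rewrite mulr_sumr; apply: eq_bigr => q _.
by rewrite !rmorphM -!mulrA; congr (_ * _); rewrite !mulrA tcomm.
Qed.

Let star_sum (V : cstarType R) (s : seq (A * B)) (F : A * B -> V) :
  star (\sum_(p <- s) F p) = \sum_(p <- s) star (F p).
Proof.
elim: s => [|p s IH]; last by rewrite !big_cons starD IH.
by rewrite !big_nil -[in LHS](scale0r (1 : V)) starZ rmorph0 scale0r.
Qed.

Let Dstar x x' : D x x' -> D (star x) (star x').
Proof.
move=> [s -> ->]; exists [seq (star p.1, star p.2) | p <- s].
  rewrite /elt big_map star_sum; apply: eq_bigr => p _.
  by rewrite starM -!starHom_star tcomm.
rewrite /elt' big_map star_sum; apply: eq_bigr => p _.
by rewrite starM -!starHom_star tcomm.
Qed.

Let Dnorm x x' : D x x' -> `|x'| <= `|x|.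
Proof.
move=> [s -> ->]; set M := `|elt s|.
have := proj2 (tnorm T' [seq (f p.1, g p.2) | p <- s] (normr_ge0 (elt s))).
rewrite big_map; apply => K L p q eta.
have /tnorm := lexx `|elt s|.
move=> /(_ (normr_ge0 _) K L (rep_comp f p) (rep_comp g q) eta).
suff -> : [seq (p x0.1 u.1, q x0.2 u.2)
    | x0 <- [seq (f p0.1, g p0.2) | p0 <- s], u <- eta] =
  [seq (rep_comp f p x0.1 u.1, rep_comp g q x0.2 u.2) | x0 <- s, u <- eta].
  by [].
by rewrite /allpairs_dep -map_comp.
Qed.

Let Ddense : closure [set x | exists x', D x x'] = setT.
Proof.
rewrite -(tdense T); congr closure; apply/seteqP; split => x /=.
  by move=> [x' [s -> _]]; exists s.
by move=> [s ->]; exists (elt' s), s.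
Qed.

Lemma tmap_exists : exists F : starHom T T',
  (forall a, F (tinl T a) = tinl T' (f a)) /\
  (forall b, F (tinr T b) = tinr T' (g b)).
Proof.
have [F FD] := starHom_extension D1 Dlin DM Dstar Dnorm Ddense.
exists F; split => [a|b]; apply: FD.
  by exists [:: (a, 1)]; rewrite /elt /elt' big_seq1 !rmorph1 mulr1.
by exists [:: (1, b)]; rewrite /elt /elt' big_seq1 !rmorph1 mul1r.
Qed.

(* The tensor product f \otimes g of two unital *-homomorphisms. *)
Definition tmap : starHom T T' := projT1 (cid tmap_exists).

Lemma tmapl a : tmap (tinl T a) = tinl T' (f a).
Proof. exact: (projT2 (cid tmap_exists)).1. Qed.

Lemma tmapr b : tmap (tinr T b) = tinr T' (g b).
Proof. exact: (projT2 (cid tmap_exists)).2. Qed.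

End TensorMap.

Record SLZ (n : nat) := SLZ_of {
  SLmx :> 'M[int]_n;
  SL_det : \det SLmx = 1
}.

Definition hyperbolic (R : realType) (n : nat) (sigma : SLZ n) : Prop :=
  forall z : R[i], eigenvalue (map_mx intr sigma : 'M[R[i]]_n) z -> `|z| != 1.

(* Z^n is the dual of T^n = R^n / Z^n, whose points are columns on which sigma
   acts by [x |-> sigma *m x]: the row m stands for the character [torus_char m]
   below, and [torus_char_dual_aut] says that [dual_aut] is chi |-> chi \o sigma. *)
Section Dual.
Variables (n : nat) (sigma : SLZ n).
Implicit Types (m : 'rV[int]_n) (k : int).

Definition dual_aut m : 'rV[int]_n := m *m sigma.
Definition dual_aut_inv m : 'rV[int]_n := m *m invmx sigma.

Lemma SL_unit : (sigma : 'M[int]_n) \in unitmx.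
Proof. by rewrite unitmxE SL_det unitr1. Qed.

Lemma dual_autK : cancel dual_aut dual_aut_inv.
Proof. by move=> m; rewrite /dual_aut_inv mulmxK ?SL_unit. Qed.

Lemma dual_aut_invK : cancel dual_aut_inv dual_aut.
Proof. by move=> m; rewrite /dual_aut mulmxKV ?SL_unit. Qed.

Definition dual_aut_pow k m : 'rV[int]_n :=
  match k with
  | Posz j => iter j dual_aut m
  | Negz j => iter j.+1 dual_aut_inv m
  end.

Lemma dual_aut_powS k m : dual_aut_pow (k + 1) m = dual_aut (dual_aut_pow k m).
Proof.
case: k => [j|[|j]]; first by rewrite addrC -intS.
  by rewrite NegzE addNr /= dual_aut_invK.
rewrite [in LHS]NegzE intS opprD addrAC addNr add0r -NegzE /=.
by rewrite dual_aut_invK.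
Qed.

Lemma dual_aut_powB k m :
  dual_aut_pow (k - 1) m = dual_aut_inv (dual_aut_pow k m).
Proof.
by rewrite -[k in RHS](subrK 1) dual_aut_powS dual_autK.
Qed.

Lemma dual_aut_powD k l m :
  dual_aut_pow (k + l) m = dual_aut_pow k (dual_aut_pow l m).
Proof.
elim: k => [|j IH|j IH]; first by rewrite add0r.
  by rewrite intS [1 + _]addrC addrAC !dual_aut_powS IH.
by rewrite intS opprD [- 1 + _]addrC addrAC !dual_aut_powB IH.
Qed.

Lemma dual_aut_powDr k m1 m2 :
  dual_aut_pow k (m1 + m2) = dual_aut_pow k m1 + dual_aut_pow k m2.
Proof.
elim: k => [//|j IH|j IH].
  by rewrite intS [1 + _]addrC !dual_aut_powS IH /dual_aut mulmxDl.
by rewrite intS opprD [- 1 + _]addrC !dual_aut_powB IH /dual_aut_inv mulmxDl.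
Qed.

Lemma dual_aut_pow0 k : dual_aut_pow k 0 = 0.
Proof. by apply: (addrI (dual_aut_pow k 0)); rewrite -dual_aut_powDr !addr0. Qed.

End Dual.

(* Z^n \rtimes Z, the generator of Z acting on Z^n by [dual_aut]. *)
Definition Gamma (n : nat) (sigma : SLZ n) : Type := ('rV[int]_n * int)%type.

Section SemidirectProduct.
Variables (n : nat) (sigma : SLZ n).
Local Notation Gamma := (Gamma sigma).

Definition Gamma_mul (x y : Gamma) : Gamma :=
  (x.1 + dual_aut_pow sigma x.2 y.1, x.2 + y.2).
Definition Gamma_one : Gamma := (0, 0).
Definition Gamma_inv (x : Gamma) : Gamma := (- dual_aut_pow sigma (- x.2) x.1, - x.2).

Lemma Gamma_mulA : associative Gamma_mul.
Proof.
move=> x y z; rewrite /Gamma_mul /= addrA; congr (_, _).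
by rewrite dual_aut_powDr addrA dual_aut_powD.
Qed.

Lemma Gamma_mul1 : left_id Gamma_one Gamma_mul.
Proof. by case=> m k; rewrite /Gamma_mul /= !add0r. Qed.

Lemma Gamma_mulr1 : right_id Gamma_one Gamma_mul.
Proof. by case=> m k; rewrite /Gamma_mul /= dual_aut_pow0 !addr0. Qed.

Lemma Gamma_mulV : left_inverse Gamma_one Gamma_inv Gamma_mul.
Proof. by case=> m k; rewrite /Gamma_mul /= !addNr. Qed.

Lemma Gamma_mulrV : right_inverse Gamma_one Gamma_inv Gamma_mul.
Proof.
case=> m k; rewrite /Gamma_mul /= subrr; congr (_, _).
have -> : dual_aut_pow sigma k (- dual_aut_pow sigma (- k) m) = - m; last exact: subrr.
apply: (addIr m); rewrite addNr -{2}[m]/(dual_aut_pow sigma 0 m) -(subrr k).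
by rewrite dual_aut_powD -dual_aut_powDr addNr dual_aut_pow0.
Qed.

HB.instance Definition _ := Choice.copy Gamma ('rV[int]_n * int)%type.
HB.instance Definition _ := isGroup.Build Gamma
  Gamma_mulA Gamma_mul1 Gamma_mulr1 Gamma_mulV Gamma_mulrV.

End SemidirectProduct.

Definition torus_char (R : realType) (n : nat) (m : 'rV[int]_n) (x : 'cV[R]_n)
    : R[i] :=
  let t := 2 * pi * (map_mx intr m *m x) 0 0 in Complex (cos t) (sin t).

Lemma torus_char_dual_aut (R : realType) (n : nat) (sigma : SLZ n)
    (m : 'rV[int]_n) (x : 'cV[R]_n) :
  torus_char (dual_aut sigma m) x = torus_char m (map_mx intr sigma *m x).
Proof. by rewrite /torus_char map_mxM mulmxA. Qed.

Record unitaryRep (R : realType) (G : groupType) (K : hilbertType R) :=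
  UnitaryRep {
  urep_fun :> G -> {linear K -> K};
  urep_one : forall x, urep_fun 1%g x = x;
  urepM : forall g h x, urep_fun (g * h)%g x = urep_fun g (urep_fun h x);
  urep_dot : forall g x y, hdot K (urep_fun g x) (urep_fun g y) = hdot K x y
}.

(* The full group C*-algebra: the completion of C[G] for the norm
   ||s|| = sup_U ||U(s)||, U ranging over the unitary representations of G. *)
Record groupCStar (R : realType) (G : groupType) := GroupCStar {
  gcs :> cstarType R;
  gcu : G -> gcs;
  gcu1 : gcu 1%g = 1;
  gcuM : forall g h, gcu (g * h)%g = gcu g * gcu h;
  gcu_star : forall g, star (gcu g) = gcu (g^-1)%g;
  gcu_dense : closure [set x | exists s : seq (R[i] * G),
                x = \sum_(p <- s) p.1 *: gcu p.2] = setT;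
  gcu_norm : forall (s : seq (R[i] * G)) (M : R[i]), 0 <= M ->
    (`|\sum_(p <- s) p.1 *: gcu p.2| <= M <->
     forall (K : hilbertType R) (U : unitaryRep G K) (x : K),
       `|\sum_(p <- s) p.1 *: U p.2 x| <= M * `|x|)
}.

Section UnitInterval.
Variable R : realType.

Definition I01 : Type := set_type (`[0 : R, 1]%classic : set R).

Fact I01_0_subproof : (0 : R) \in (`[0 : R, 1]%classic : set R).
Proof. by rewrite inE /= in_itv /= lexx ler01. Qed.

Fact I01_1_subproof : (1 : R) \in (`[0 : R, 1]%classic : set R).
Proof. by rewrite inE /= in_itv /= lexx ler01. Qed.

Definition I01_0 : I01 := exist _ (0 : R) I01_0_subproof.
Definition I01_1 : I01 := exist _ (1 : R) I01_1_subproof.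
End UnitInterval.

Section Coaction.
Variable R : realType.

Program Definition idHom (A : cstarType R) : starHom A A := @StarHom R A A idfun _.
Next Obligation. by []. Qed.

Definition lspan (V : lmodType R[i]) (S : set V) : set V :=
  [set x | exists2 s : seq (R[i] * V), (forall p, p \in s -> S p.2) &
     x = \sum_(p <- s) p.1 *: p.2].

(* The canonical isomorphism (A \otimes B) \otimes C ~ A \otimes (B \otimes C). *)
Record associator (A B C : cstarType R) (AB : minTensor A B)
    (AB_C : minTensor AB C) (BC : minTensor B C) (A_BC : minTensor A BC) :=
  Associator {
  assoc :> starHom AB_C A_BC;
  assoc_bij : bijective assoc;
  assocl : forall a, assoc (tinl AB_C (tinl AB a)) = tinl A_BC a;
  assocm : forall b, assoc (tinl AB_C (tinr AB b)) = tinr A_BC (tinl BC b);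
  assocr : forall c, assoc (tinr AB_C c) = tinr A_BC (tinr BC c)
}.

Variables (H : cstarType R) (HH : minTensor H H) (Delta : starHom H HH).

Definition equivariant (A B : cstarType R) (AH : minTensor A H)
    (BH : minTensor B H) (dA : starHom A AH) (dB : starHom B BH)
    (phi : starHom A B) : Prop :=
  forall a, dB (phi a) = tmap AH BH phi (idHom H) (dA a).

Variables (A : cstarType R) (AH : minTensor A H).
Variables (AH_H : minTensor AH H) (A_HH : minTensor A HH).
Variable alpha : associator AH_H A_HH.
Variable delta : starHom A AH.

Definition coaction : Prop := [/\
  injective delta,
  forall a, alpha (tmap AH AH_H delta (idHom H) (delta a)) =
            tmap AH A_HH (idHom A) Delta (delta a) &
  closure (lspan [set x | exists a h, x = delta a * tinr AH h]) = setT].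

Definition free_coaction : Prop :=
  closure [set x | exists s : seq (A * A),
    x = \sum_(p <- s) tinl AH p.1 * delta p.2] = setT.

(* The C*-algebra of the continuous F : [0, 1] -> A \otimes H such that
   F 0 \in C \otimes H and F 1 \in delta(A), with pointwise operations and the
   supremum norm; [jev t] is the evaluation at t. *)
Record ncjoin := NCJoin {
  ncj :> cstarType R;
  jev : I01 R -> starHom ncj AH;
  jev_inj : forall f g, (forall t, jev t f = jev t g) -> f = g;
  jev_norm : forall f (M : R[i]), 0 <= M ->
    (`|f| <= M <-> forall t, `|jev t f| <= M);
  jevP : forall F : I01 R -> AH,
    (exists f, forall t, jev t f = F t) <->
    [/\ continuous F,
        exists h, F (I01_0 R) = tinr AH h &
        exists a, F (I01_1 R) = delta a]
}.

(* [dJ] is id \otimes Delta applied at each t; [tmap _ _ (jev J t) (idHom H)] is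
   the evaluation at t of an element of J \otimes H, seen as a function on [0, 1]
   with values in (A \otimes H) \otimes H. *)
Definition join_coaction (J : ncjoin) (JH : minTensor J H)
    (dJ : starHom J JH) : Prop :=
  forall t f, alpha (tmap JH AH_H (jev J t) (idHom H) (dJ f)) =
              tmap AH A_HH (idHom A) Delta (jev J t f).

End Coaction.

(* Main.v *)
(** Applying [id \otimes counit] to a [Delta]-equivariant [phi], evaluated at [t],
    turns it into a norm-continuous path of unitary representations [coef t] of
    [Gamma] in [A \otimes H] with [jev t (phi g) = coef t g * (1 \otimes g)], and
    [coef 0] is scalar. On [Z^n] put [v t m = coef t m * coef 0 (- m)]. Conjugation
    by [coef t] of the generator of [Z] is a linear isometry which maps [v t m] to
    [v t (m *m sigma)]; to first order it acts on the vector of the [v t e_i - 1]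
    as [sigma], which by hyperbolicity and Cayley-Hamilton forces
    [X <= C * X ^+ 2] for [X = \sum_i |v t e_i - 1|]. So [X] jumps from [0] to at
    least [1 / C], and since it is continuous in [t] and vanishes at [t = 0] it
    vanishes at [t = 1]. Then [delta a = lambda (1 \otimes e_0)] for some [a] and
    some scalar [lambda], and the coaction identity gives [e_0 = 1] in [H]; but
    [e_0] acts nontrivially in the permutation representation on functions on
    [(Z / 2)^n]. *)
Require Import Defs.
From HB Require Import structures.
From mathcomp Require Import all_boot all_order all_algebra.
From mathcomp Require Import boolp classical_sets functions reals topology normedtype.
From mathcomp Require Import sequences complex sesquilinear ring.

Set Implicit Arguments.
Unset Strict Implicit.
Unset Printing Implicit Defensive.

Import Order.TTheory GRing.Theory Num.Theory.
Import numFieldNormedType.Exports.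

Local Open Scope classical_set_scope.
Local Open Scope ring_scope.

(** * Contractivity of *-homomorphisms *)

Section ComplexSequences.
Variable R : realType.

Lemma ge0_complexE (x : R[i]) : 0 <= x -> exists2 r : R, 0 <= r & x = r%:C%C.
Proof. by case: x => r s; rewrite lecE /= => /andP[/eqP -> r0]; exists r. Qed.

Lemma complex_archi (e : R[i]) : 0 < e -> exists n : nat, (n.+1%:R)^-1 < e.
Proof.
move=> e0; have [r _ er] := ge0_complexE (ltW e0).
move: e0; rewrite er ltcR => r0.
exists (Num.truncn r^-1); rewrite -(rmorph_nat (real_complex R)) -fmorphV ltcR.
by rewrite invf_plt ?posrE//; exact: truncnS_gt.
Qed.

Lemma complex_exp_lt (q e : R[i]) : 0 <= q -> q < 1 -> 0 < e -> exists n, q ^+ n < e.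
Proof.
move=> q0 q1 e0.
have [r r0 qr] := ge0_complexE q0; have [s _ es] := ge0_complexE (ltW e0).
move: q1 e0; rewrite qr es -(rmorph1 (real_complex R)) !ltcR => r1 s0.
have rr : `|r| < 1 by rewrite ger0_norm.
have /cvgrPdist_lt /(_ _ s0) [n _ Hn] := cvg_expr rr.
exists n; rewrite -rmorphXn ltcR.
by have := Hn n (leqnn n); rewrite sub0r normrN ger0_norm ?exprn_ge0.
Qed.

Lemma cauchy_lim (V : completeNormedModType R[i]) (u : nat -> V) :
  (forall e : R[i], 0 < e -> exists N, forall m, (N <= m)%N -> `|u N - u m| < e) ->
  exists l, forall e : R[i], 0 < e ->
    exists N, forall m, (N <= m)%N -> `|l - u m| < e.
Proof.
move=> uC; have /cauchy_cvgP /cvg_ex [l ul] : cauchy (u @ \oo).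
  apply/cauchyP => e e0; have [N HN] := uC e e0.
  by exists (u N), N => // m /= /HN; rewrite -ball_normE.
exists l => e e0; move/cvgrPdist_lt : ul => /(_ e e0)[N _ HN].
by exists N => m; exact: HN.
Qed.
End ComplexSequences.

Section CStarBasics.
Variables (R : realType) (A : cstarType R).
Implicit Types x y : A.

Lemma star1 : star 1 = 1 :> A.
Proof. by rewrite -[LHS]mulr1 -{2}[1](@starK R A) -starM mulr1 starK. Qed.

Lemma cstar_norm1 : `|1 : A| = 1.
Proof.
have n1 : `|1 : A| != 0 by rewrite normr_eq0 oner_eq0.
by apply: (mulIf n1); rewrite mul1r -expr2 -cstar_norm_star star1 mul1r.
Qed.

Lemma star0 : star 0 = 0 :> A.
Proof. by rewrite -[0](scale0r (1 : A)) starZ rmorph0 !scale0r. Qed.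

Lemma starN x : star (- x) = - star x.
Proof. by rewrite -scaleN1r starZ rmorphN1 scaleN1r. Qed.

Lemma starB x y : star (x - y) = star x - star y.
Proof. by rewrite starD starN. Qed.

Lemma isometry_norm x : star x * x = 1 -> `|x| = 1.
Proof.
move=> xx; have := cstar_norm_star x; rewrite xx cstar_norm1 => /esym/eqP.
by rewrite sqrp_eq1 // => /eqP.
Qed.

End CStarBasics.

(** * A square root of [1 - y * y] for a self-adjoint strict contraction *)

Section SquareRoot.
Variables (R : realType) (A : cstarType R) (y : A).
Hypothesis (y_sa : star y = y) (y_lt1 : `|y| < 1).

Let two_neq0 : (2 : R[i]) != 0. Proof. by rewrite pnatr_eq0. Qed.

(** Fixed-point iteration for [l = (y * y + l * l) / 2], an equation equivalent to
    [(1 - l) ^+ 2 = 1 - y * y]. On the ball of radius [|y|] the iterated map is Lipschitz with ratio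
    [|y| < 1], so the iterates converge in norm. *)
Let s := fix s n : A := if n is m.+1 then 2^-1 *: (y * y + s m * s m) else 0.

Let sS n : s n.+1 = 2^-1 *: (y * y + s n * s n). Proof. by []. Qed.

Let s_comm n : s n * y = y * s n.
Proof.
elim: n => [|n IH]; first by rewrite mul0r mulr0.
have ssy : s n * s n * y = y * (s n * s n) by rewrite -mulrA IH !mulrA IH.
by rewrite sS -scalerAl -scalerAr mulrDl mulrDr ssy !mulrA.
Qed.

Let s_sa n : star (s n) = s n.
Proof.
elim: n => [|n IH]; first exact: star0.
by rewrite sS starZ fmorphV rmorph_nat starD !starM y_sa IH.
Qed.

Let s_norm n : `|s n| <= `|y|.
Proof.
elim: n => [|n IH]; first by rewrite normr0.
rewrite sS normrZ normfV normr_nat mulrC ler_pdivrMr // mulr_natr mulr2n.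
rewrite (le_trans (ler_normD _ _)) // lerD //.
  by rewrite (le_trans (cstar_normM _ _)) // ler_piMl // ltW.
rewrite (le_trans (cstar_normM _ _)) // (le_trans (ler_pM _ _ IH IH)) //.
by rewrite ler_piMl // ltW.
Qed.

Let sq_lip (a b : A) : `|a| <= `|y| -> `|b| <= `|y| ->
  `|2^-1 *: (y * y + a * a) - 2^-1 *: (y * y + b * b)| <= `|y| * `|a - b|.
Proof.
move=> ay bY; rewrite -scalerBr opprD addrACA subrr add0r.
have -> : a * a - b * b = a * (a - b) + (a - b) * b.
  by rewrite mulrBr mulrBl addrA subrK.
rewrite normrZ normfV normr_nat mulrC ler_pdivrMr // mulr_natr mulr2n.
rewrite (le_trans (ler_normD _ _)) // lerD //.
  by rewrite (le_trans (cstar_normM _ _)) // ler_wpM2r.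
by rewrite (le_trans (cstar_normM _ _)) // mulrC ler_wpM2r.
Qed.

Let s_dist n k : `|s n - s (n + k)| <= `|y| ^+ n.
Proof.
elim: n => [|n IH].
  by rewrite add0n sub0r normrN (le_trans (s_norm _)) // ltW.
rewrite addSn !sS (le_trans (sq_lip _ _)) // exprS ler_wpM2l //.
Qed.

Lemma sqrt_one_minus_sqr :
  exists z : A, [/\ star z = z, z * y = y * z & y * y + z * z = 1].
Proof.
have [|l sl] := @cauchy_lim R A s.
  move=> e e0; have [n ne] := complex_exp_lt (normr_ge0 y) y_lt1 e0.
  exists n => m nm; rewrite -(subnKC nm).
  exact: le_lt_trans (s_dist _ _) ne.
(* Each property of the limit [l] is the vanishing of some [x] dominated by the errors of the
   iterates. The error at [n.+1] enters because the fixed-point equation compares two consecutive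
   iterates. *)
have lim0 (x : A) (C : R[i]) : 0 <= C ->
    (forall n, `|x| <= C * (`|l - s n| + `|l - s n.+1|)) -> x = 0.
  move=> C0 xC; apply/normr0_eq0/le_anti; rewrite normr_ge0 andbT.
  apply/ler_addgt0Pr => e e0; rewrite add0r.
  have C1 : 0 < C + 1 by rewrite ltr_wpDl.
  have d0 : 0 < e / (C + 1) / 2 by rewrite !divr_gt0.
  have [N HN] := sl _ d0.
  have le_d : `|l - s N| + `|l - s N.+1| <= e / (C + 1).
    by rewrite [leRHS]splitr lerD // ltW // HN.
  apply: le_trans (xC N) _; apply: le_trans (ler_wpM2l C0 le_d) _.
  by rewrite mulrCA ler_piMr ?(ltW e0) // ler_pdivrMr // mul1r lerDl.
have l_sa : star l = l.
  apply/eqP; rewrite -subr_eq0; apply/eqP; apply: (lim0 _ 2) => // n.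
  have -> : star l - l = star (l - s n) - (l - s n).
    by rewrite starB s_sa opprB addrA subrK.
  rewrite (le_trans (ler_normB _ _)) // cstar_norm_starE -mulr2n.
  by rewrite -[leLHS]mulr_natl ler_wpM2l // lerDl.
have l_comm : l * y = y * l.
  apply/eqP; rewrite -subr_eq0; apply/eqP; apply: (lim0 _ (2 * `|y|)) => [|n].
    by rewrite mulr_ge0.
  have -> : l * y - y * l = (l - s n) * y - y * (l - s n).
    by rewrite mulrBl mulrBr s_comm opprB addrA subrK.
  apply: (@le_trans _ _ (2 * `|y| * `|l - s n|)); last first.
    by rewrite ler_wpM2l ?mulr_ge0 // lerDl.
  rewrite (le_trans (ler_normB _ _)) // -mulrA mulr_natl mulr2n lerD //.
    by rewrite mulrC cstar_normM.
  exact: cstar_normM.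
have l_norm : `|l| <= `|y|.
  apply/ler_addgt0Pr => e e0; have [N HN] := sl e e0.
  rewrite -(subrK (s N) l) (le_trans (ler_normD _ _)) // addrC lerD //.
  exact/ltW/HN.
have l_fix : l = 2^-1 *: (y * y + l * l).
  apply/eqP; rewrite -subr_eq0; apply/eqP; apply: (lim0 _ (1 + `|y|)) => [|n].
    by rewrite addr_ge0.
  have -> : l - 2^-1 *: (y * y + l * l) =
      (l - s n.+1) + (2^-1 *: (y * y + s n * s n) - 2^-1 *: (y * y + l * l)).
    by rewrite sS addrA subrK.
  rewrite (le_trans (ler_normD _ _)) // (le_trans (lerD (lexx _) (sq_lip _ _))) //.
  rewrite [`|s n - l|]distrC mulrDl mul1r mulrDr lerD ?lerDr ?lerDl ?mulr_ge0 //.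
exists (1 - l); split.
- by rewrite starB star1 l_sa.
- by rewrite mulrBl mulrBr mul1r mulr1 l_comm.
- have yyll : y * y + l * l = l + l.
    by rewrite -mulr2n -scaler_nat {3}l_fix scalerA divff // scale1r.
  rewrite mulrBr mulr1 mulrBl mul1r opprB addrACA -opprD.
  by rewrite (canRL (addrK _) yyll) -[1 + _ - _]addrA -(opprB (l + l)) addrCA subrr addr0.
Qed.
End SquareRoot.

Section Contractive.
Variables (R : realType) (A B : cstarType R) (f : starHom A B).

(* [y = (w + star w) / 2] for the unitary [w = y + 'i sqrt (1 - y ^+ 2)]. *)
Let sa_lt1 (y : A) : star y = y -> `|y| < 1 -> `|f y| <= 1.
Proof.
move=> y_sa y_lt1; have [z [z_sa zy yz]] := sqrt_one_minus_sqr y_sa y_lt1.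
pose w := y + 'i *: z.
have star_w : star w = y - 'i *: z.
  by rewrite starD starZ y_sa z_sa conjCi scaleNr.
have ww : star w * w = 1.
  rewrite star_w mulrDr !mulrBl -!scalerAr -!scalerAl zy scalerA -(expr2 'i) sqrCi.
  by rewrite scaleN1r opprK addrA subrK.
have fw : `|f w| = 1.
  by apply: isometry_norm; rewrite -starHom_star -rmorphM ww rmorph1.
have -> : y = 2^-1 *: (w + star w).
  by rewrite star_w addrACA subrr addr0 scalerDr -scalerDl -[2^-1]mul1r -splitr scale1r.
rewrite linearZ linearD /= normrZ normfV normr_nat mulrC ler_pdivrMr // mul1r.
by rewrite (le_trans (ler_normD _ _)) // starHom_star cstar_norm_starE fw.
Qed.

(** The C*-identity reduces the claim to the self-adjoint element [star x * x]; a self-adjoint [y]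
    is divided by [|y| + e] to fall in the open unit ball, where [sa_lt1] applies. *)
Lemma starHom_norm_le (x : A) : `|f x| <= `|x|.
Proof.
suff sa (y : A) : star y = y -> `|f y| <= `|y|.
  rewrite -(@ler_pXn2r _ 2) ?nnegrE // -!cstar_norm_star -starHom_star -rmorphM.
  by apply: sa; rewrite starM starK.
move=> y_sa; apply/ler_addgt0Pr => e e0; set t := `|y| + e.
have t0 : 0 < t by rewrite ltr_wpDl.
have tE : `|t^-1| = t^-1 by rewrite ger0_norm // invr_ge0 ltW.
have -> : f y = t *: f (t^-1 *: y) by rewrite -linearZ scalerA divff ?scale1r ?gt_eqF.
rewrite normrZ (ger0_norm (ltW t0)) ler_piMr ?(ltW t0) //; apply: sa_lt1.
  by rewrite starZ y_sa; congr (_ *: _); rewrite conj_Creal // ger0_real // -tE.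
by rewrite normrZ tE mulrC ltr_pdivrMr // mul1r ltrDl.
Qed.

End Contractive.

(** * Finite-dimensional Hilbert spaces *)

Definition l2 (R : realType) (I : finType) : Type := {ffun I -> R[i]^o}.

Section EuclideanSpace.
Variables (R : realType) (I : finType).
Local Notation l2 := (l2 R I).
HB.instance Definition _ := Vector.copy l2 {ffun I -> R[i]^o}.

Definition l2_dot (f g : l2) : R[i] :=
  \sum_i (f : {ffun I -> _}) i * Num.conj ((g : {ffun I -> _}) i).

Let l2_dot_bilinear :
  bilinear_for *%R (Num.conj \; *%R) l2_dot.
Proof.
split=> u c f g; rewrite /l2_dot /= mulr_sumr -big_split /=;
  apply: eq_bigr => i _; rewrite !ffunE.
  by rewrite mulrDl -mulrA.
by rewrite rmorphD rmorphM /= mulrDr mulrCA.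
Qed.

HB.instance Definition _ := bilinear_isBilinear.Build R[i] l2 l2 R[i]
  *%R (Num.conj \; *%R) l2_dot l2_dot_bilinear.

Let l2_dot_herm (f g : l2) : l2_dot f g = (-1) ^+ false * Num.conj (l2_dot g f).
Proof.
rewrite expr0 mul1r rmorph_sum; apply: eq_bigr => i _.
by rewrite rmorphM /= conjCK mulrC.
Qed.

HB.instance Definition _ := isHermitianSesquilinear.Build R[i] l2 false Num.conj
  l2_dot l2_dot_herm.

Let l2_dot_gt0 (f : l2) : f != 0 -> 0 < l2_dot f f.
Proof.
move=> f0; have [i fi0] : exists i, (f : {ffun I -> _}) i != 0.
  apply/existsP; apply: contraR f0; rewrite negb_exists => /forallP f0.
  by apply/eqP/ffunP => i; rewrite ffunE; apply/eqP; have := f0 i; rewrite negbK.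
rewrite /l2_dot (bigD1 i) //= -normCK ltr_wpDr ?exprn_gt0 ?normr_gt0 //.
by apply: sumr_ge0 => j _; rewrite -normCK exprn_ge0.
Qed.

HB.instance Definition _ := isDotProduct.Build R[i] l2 l2_dot l2_dot_gt0.

Definition l2_norm (f : l2) : R[i] := sqrtC (l2_dot f f).

Let l2_ler_normD (f g : l2) : l2_norm (f + g) <= l2_norm f + l2_norm g.
Proof. by have [] := triangle_lerif l2_dot f g. Qed.

Let l2_normrZ (c : R[i]) (f : l2) : l2_norm (c *: f) = `|c| * l2_norm f.
Proof.
by rewrite /l2_norm dnormZ sqrtCM ?nnegrE ?exprn_ge0 // sqrCK.
Qed.

Let l2_norm_eq0 (f : l2) : l2_norm f = 0 -> f = 0.
Proof. by move=> /eqP; rewrite /l2_norm sqrt_dnorm_eq0 => /eqP. Qed.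

HB.instance Definition _ := Lmodule_isNormed.Build R[i] l2
  l2_ler_normD l2_normrZ l2_norm_eq0.


Lemma l2_normE (f : l2) : `|f| = l2_norm f. Proof. by []. Qed.

(** Splitting each entry into real and imaginary parts reduces completeness of [l2] to that of [R],
    one real coordinate at a time. *)
Definition l2_coord (p : I * bool) (f : l2) : R :=
  let z := (f : {ffun I -> _}) p.1 in
  if p.2 then complex.Re z else complex.Im z.

Let l2_coordB p (f g : l2) : l2_coord p (f - g) = l2_coord p f - l2_coord p g.
Proof.
rewrite /l2_coord !ffunE; case: p.2;
by case: ((f : {ffun I -> _}) p.1) => a b; case: ((g : {ffun I -> _}) p.1) => c d.
Qed.

Let l2_coord_le p (f : l2) : (`|l2_coord p f|)%:C%C <= `|f|.
Proof.
case: p => i b; set z := (f : {ffun I -> _}) i.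
have le_z : (`|l2_coord (i, b) f|)%:C%C <= `|z|.
  rewrite /l2_coord -/z /=; case: z => x y; rewrite normc_def lecR -sqrtr_sqr.
  by rewrite ler_wsqrtr //; case: b; rewrite ?lerDl ?lerDr sqr_ge0.
apply: le_trans le_z _; rewrite l2_normE -(@ler_pXn2r _ 2) ?nnegrE ?sqrt_dnorm_ge0 //.
rewrite sqrtCK /l2_dot (bigD1 i) //= -normCK lerDl.
by apply: sumr_ge0 => j _; rewrite -normCK exprn_ge0.
Qed.

Let l2_norm_le (f : l2) : `|f| <= \sum_p (`|l2_coord p f|)%:C%C.
Proof.
have sumsq (s : seq I) (a : I -> R[i]) : (forall i, 0 <= a i) ->
    \sum_(i <- s) a i ^+ 2 <= (\sum_(i <- s) a i) ^+ 2.
  move=> a0; elim: s => [|i s IH]; first by rewrite !big_nil expr0n.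
  rewrite !big_cons sqrrD -addrA lerD2l (le_trans IH) // lerDr mulrn_wge0 //.
  by rewrite mulr_ge0 // sumr_ge0.
apply: (@le_trans _ _ (\sum_i `|(f : {ffun I -> _}) i|)).
  rewrite l2_normE -(@ler_pXn2r _ 2) ?nnegrE ?sqrt_dnorm_ge0 ?sumr_ge0 //.
  rewrite sqrtCK /l2_dot.
  under eq_bigr => i _ do rewrite -normCK.
  exact: sumsq.
rewrite -(pair_bigA _ (fun i b => (`|l2_coord (i, b) f|)%:C%C)) /=.
apply: ler_sum => i _; rewrite big_bool /= /l2_coord /=.
case: ((f : {ffun I -> _}) i) => x y /=.
have -> : Complex x y = x%:C%C + 'i%C * y%:C%C by simpc.
rewrite (le_trans (ler_normD _ _)) // normrM !normc_def /= !expr0n /= !addr0 add0r.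
by rewrite expr1n sqrtr1 mul1r !sqrtr_sqr.
Qed.

Let l2_complete (F : set_system l2) : ProperFilter F -> cauchy F -> cvg F.
Proof.
move=> FF Fc.
have /choice[l Hl] p : exists l : R, l2_coord p @ F --> l.
  apply/cvg_ex/cauchy_cvgP/cauchyP => e e0.
  have /cauchyP /(_ (e%:C%C)) := Fc; rewrite ltcR => /(_ e0)[x Fx].
  exists (l2_coord p x); suff : F (l2_coord p @^-1` ball (l2_coord p x) e) by [].
  apply: filterS Fx => y; rewrite -!ball_normE /= => xy.
  by rewrite -l2_coordB -ltcR; apply: le_lt_trans xy; exact: l2_coord_le.
pose L : l2 := [ffun i => Complex (l (i, true)) (l (i, false))].
apply/cvg_ex; exists L; apply/cvgrPdist_lt => e e0.
have [r r0 er] := ge0_complexE (ltW e0).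
move: e0; rewrite er ltcR => {r0} r0.
(* One more than the number of real coordinates: the errors [r / N] then add up to strictly less
   than [r], and [N] is nonzero even when [I] is empty. *)
pose N : R := #|{: I * bool}|.+1%:R.
have N0 : 0 < N by rewrite ltr0n.
have near_all : \forall f \near F, forall p, `|l p - l2_coord p f| < r / N.
  apply: filter_forall => p; have /cvgrPdist_lt := Hl p; apply.
  exact: divr_gt0.
apply: filterS near_all => f Hf.
apply: le_lt_trans (l2_norm_le _) _; rewrite -rmorph_sum ltcR.
apply: (@le_lt_trans _ _ (\sum_(p : I * bool) r / N)).
  apply: ler_sum => p _; rewrite l2_coordB.
  have -> : l2_coord p L = l p by case: p => i [] /=; rewrite /l2_coord ffunE.
  exact/ltW/Hf.
rewrite sumr_const -[_ *+ _]mulr_natr mulrAC ltr_pdivrMr // ltr_pM2l //.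
by rewrite ltr_nat.
Qed.

HB.instance Definition _ := Uniform_isComplete.Build l2 l2_complete.

Let l2_dotE (f : l2) : l2_dot f f = `|f| ^+ 2.
Proof. by rewrite l2_normE sqrtCK. Qed.

Definition l2_hilbert : hilbertType R := @Hilbert R l2 l2_dot l2_dotE.

End EuclideanSpace.

(** * From unitary representations to *-representations *)

Lemma linear_at0 (K : pzRingType) (V W : lmodType K) (f : V -> W) :
  linear f -> f 0 = 0.
Proof. by move=> /(_ (-1) 0 0); rewrite scaler0 addr0 scaleN1r addNr. Qed.

Lemma closure_normP (R : realType) (V : normedModType R[i]) (S : set V) :
  closure S = setT <->
  forall x (e : R[i]), 0 < e -> exists2 y, S y & `|x - y| < e.
Proof.
split=> [SV x e e0|SV].
  have : closure S x by rewrite SV.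
  move=> /(_ (ball x e) (nbhsx_ballx _ _ e0)) [y [Sy]].
  by rewrite -ball_normE => xy; exists y.
apply/seteqP; split=> // x _ B /nbhs_ballP [e e0 xeB].
have [y Sy xy] := SV x e e0; exists y; split=> //.
by apply: xeB; rewrite -ball_normE.
Qed.

Lemma bounded_linear_dense_eq0 (R : realType) (V W : normedModType R[i])
    (S : set V) (f : V -> W) (C : R[i]) :
  closure S = setT -> linear f -> (forall x, `|f x| <= C * `|x|) ->
  (forall x, S x -> f x = 0) -> forall x, f x = 0.
Proof.
move=> /closure_normP Sd f_lin fC fS x; apply/normr0_eq0/le_anti.
rewrite normr_ge0 andbT; apply/ler_addgt0Pr => e e0; rewrite add0r.
have C1 : 0 < `|C| + 1 by rewrite ltr_wpDl.
have [y Sy xy] := Sd x (e / (`|C| + 1)) (divr_gt0 e0 C1).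
have fxy : f x = f (x - y).
  by have := f_lin (-1) y x; rewrite !scaleN1r (fS y Sy) oppr0 add0r addrC => ->.
(* [C] is only an element of [R[i]], so it must be seen to be real before it is compared with its
   modulus. The bound on [f] forces this as soon as [x != y]. *)
have C_ge0 : C * `|x - y| <= `|C| * `|x - y|.
  have [->|n0] := eqVneq `|x - y| 0; first by rewrite !mulr0.
  rewrite ler_pM2r ?lt_def ?n0 ?normr_ge0 // real_ler_norm // realE.
  have : 0 <= C * `|x - y| by apply: le_trans (fC _).
  by rewrite pmulr_lge0 ?lt_def ?n0 ?normr_ge0 // => ->.
rewrite fxy (le_trans (fC _)) // (le_trans C_ge0) //.
move/ltW : xy; rewrite ler_pdivlMr // => /(le_trans _); apply.
by rewrite mulrC ler_wpM2l // lerDl.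
Qed.

Section HilbertSpace.
Variables (R : realType) (K : hilbertType R).

Lemma hilbert_CauchySchwarz (x y : K) : `|hdot K x y| <= `|x| * `|y|.
Proof.
have [->|y0] := eqVneq y 0; first by rewrite linear0r normr0 mulr_ge0.
rewrite -(@ler_pXn2r _ 2) ?nnegrE ?mulr_ge0 // exprMn.
have ny : 0 < `|y| ^+ 2 by rewrite exprn_gt0 // normr_gt0.
rewrite -subr_ge0 -(pmulr_rge0 _ ny).
have -> : `|y| ^+ 2 * (`|x| ^+ 2 * `|y| ^+ 2 - `|hdot K x y| ^+ 2) =
    `| (`|y| ^+ 2 *: x - hdot K x y *: y) | ^+ 2; last exact: exprn_ge0.
have yx : hdot K y x = Num.conj (hdot K x y) by rewrite hermC expr0 mul1r.
have yr : Num.conj (`|y| ^+ 2) = `|y| ^+ 2.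
  by rewrite conj_Creal // ger0_real // exprn_ge0.
rewrite -[RHS]hdotE linearBl !linearBr !linearZl_LR !linearZr_LR /= yx yr !hdotE.
rewrite normCK; move: (`|x| ^+ 2) (`|y| ^+ 2) (hdot K x y) => a b d.
by move: (Num.conj d) => d'; ring.
Qed.

End HilbertSpace.

(** * Extension of a unitary representation to the full group algebra *)

Section RepExtension.
Variables (R : realType) (G : groupType) (H : groupCStar R G).
Variables (K : hilbertType R) (U : unitaryRep G K).

(** This reduces identities between bounded linear expressions on [H] to group elements, whose span
    is dense. *)
Lemma groupCStar_linear_eq0 (W : normedModType R[i]) (f : H -> W) (C : R[i]) :
  linear f -> (forall h, `|f h| <= C * `|h|) ->
  (forall g, f (gcu H g) = 0) -> forall h, f h = 0.
Proof.
move=> f_lin fC fG; apply: (bounded_linear_dense_eq0 (gcu_dense H) f_lin fC).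
have f0 : f 0 = 0 by exact: linear_at0.
move=> _ [s ->]; elim: s => [|p s IH]; first by rewrite big_nil.
by rewrite big_cons f_lin IH fG scaler0 addr0.
Qed.

Let gsum (s : seq (R[i] * G)) : H := \sum_(p <- s) p.1 *: gcu H p.2.
Let usum (s : seq (R[i] * G)) (x : K) : K := \sum_(p <- s) p.1 *: U p.2 x.

Let usum_le s x : `|usum s x| <= `|gsum s| * `|x|.
Proof. by have /gcu_norm := lexx `|gsum s|; apply. Qed.

Let sublc (c : R[i]) (s t : seq (R[i] * G)) := s ++ [seq (c * p.1, p.2) | p <- t].

Let gsum_sublc c s t : gsum (sublc c s t) = gsum s + c *: gsum t.
Proof.
rewrite /gsum big_cat big_map scaler_sumr; congr (_ + _).
by apply: eq_bigr => p _; rewrite scalerA.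
Qed.

Let usum_sublc c s t x : usum (sublc c s t) x = usum s x + c *: usum t x.
Proof.
rewrite /usum big_cat big_map scaler_sumr; congr (_ + _).
by apply: eq_bigr => p _; rewrite scalerA.
Qed.

Let usum_dist s t x : `|usum s x - usum t x| <= `|gsum s - gsum t| * `|x|.
Proof.
rewrite -scaleN1r -[X in gsum s + X]scaleN1r -usum_sublc -gsum_sublc.
exact: usum_le.
Qed.

Let usum_lin s c x y : usum s (c *: x + y) = c *: usum s x + usum s y.
Proof.
rewrite /usum scaler_sumr -big_split; apply: eq_bigr => p _ /=.
by rewrite linearP scalerDr !scalerA mulrC.
Qed.

Let gsum_dense h (e : R[i]) : 0 < e -> exists s, `|h - gsum s| < e.
Proof.
move=> e0; have /closure_normP := gcu_dense H.
by move=> /(_ h e e0) [_ [s ->] hs]; exists s.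
Qed.

(** [y] is the limit of [usum (w n) x] along sums approximating [h]. Asking for the estimate against
    every [s] determines [y] independently of the chosen sequence, and this yields linearity in both
    [h] and [x]. *)
Let ext_exists h x : exists y, forall s, `|y - usum s x| <= `|h - gsum s| * `|x|.
Proof.
have /choice[w Hw] (n : nat) : exists s, `|h - gsum s| < (n.+1%:R)^-1.
  by apply: gsum_dense; rewrite invr_gt0.
have Hc (n : nat) m : (n <= m)%N -> `|h - gsum (w m)| < (n.+1%:R)^-1.
  move=> nm; apply: (lt_le_trans (Hw m)).
  by rewrite lef_pV2 ?posrE // ler_nat.
have x1 : 0 < `|x| + 1 by rewrite ltr_wpDl.
have [|l ul] := @cauchy_lim R K (fun n => usum (w n) x).
  move=> e e0; have d0 : 0 < e / (`|x| + 1) / 2 by rewrite !divr_gt0.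
  have [N Ne] := complex_archi d0; exists N => m Nm.
  apply: le_lt_trans (usum_dist _ _ _) _.
  have d : `|gsum (w N) - gsum (w m)| < e / (`|x| + 1).
    rewrite -(subrK h (gsum (w N))) -addrA (le_lt_trans (ler_normD _ _)) //.
    rewrite [ltRHS]splitr ltrD // ?[`|gsum _ - h|]distrC.
      by apply: lt_trans Ne; exact: Hc.
    by apply: lt_trans Ne; exact: Hc.
  apply: (@le_lt_trans _ _ (`|gsum (w N) - gsum (w m)| * (`|x| + 1))).
    by rewrite ler_wpM2l // lerDl.
  by rewrite -ltr_pdivlMr.
exists l => s; apply/ler_addgt0Pr => e e0.
have d0 : 0 < e / (`|x| + 1) by rewrite divr_gt0.
have [N1 HN1] := ul _ (divr_gt0 e0 (ltr0n _ 2)).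
have [N2 HN2] := complex_archi (divr_gt0 d0 (ltr0n _ 2)).
pose N := maxn N1 N2.
rewrite -(subrK (usum (w N) x) l) -addrA (le_trans (ler_normD _ _)) //.
rewrite [leRHS]addrC [e]splitr -addrA lerD ?(ltW (HN1 _ (leq_maxl _ _))) //.
apply: le_trans (usum_dist _ _ _) _.
apply: (@le_trans _ _ ((`|h - gsum s| + `|h - gsum (w N)|) * `|x|)).
  by rewrite ler_wpM2r // (le_trans (ler_distD h _ _)) // [leRHS]addrC lerD // distrC.
rewrite mulrDl addrC lerD //.
have := ltW (lt_trans (Hc N2 N (leq_maxr _ _)) HN2).
rewrite mulrAC ler_pdivlMr // => /(le_trans _); apply.
by rewrite ler_wpM2l // lerDl.
Qed.

Let ext h x : K := projT1 (cid (ext_exists h x)).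

Let extP h x s : `|ext h x - usum s x| <= `|h - gsum s| * `|x|.
Proof. exact: (projT2 (cid (ext_exists h x)) s). Qed.

Let ext_le h x : `|ext h x| <= `|h| * `|x|.
Proof. by have := extP h x [::]; rewrite /usum /gsum !big_nil !subr0. Qed.

Let ext_gsum s x : ext (gsum s) x = usum s x.
Proof.
have := extP (gsum s) x s; rewrite subrr normr0 mul0r normr_le0 subr_eq0.
by move=> /eqP.
Qed.

Let ext_gcu g x : ext (gcu H g) x = U g x.
Proof.
by have := ext_gsum [:: (1, g)] x; rewrite /gsum /usum !big_seq1 !scale1r.
Qed.

Let small0 (W : normedModType R[i]) (x : W) (C : R[i]) : 0 <= C ->
  (forall e, 0 < e -> `|x| <= C * e) -> x = 0.
Proof.
move=> C0 xC; apply/normr0_eq0/le_anti; rewrite normr_ge0 andbT.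
apply/ler_addgt0Pr => e e0; rewrite add0r.
have C1 : 0 < C + 1 by rewrite ltr_wpDl.
apply: le_trans (xC _ (divr_gt0 e0 C1)) _.
by rewrite mulrCA ler_piMr ?(ltW e0) // ler_pdivrMr // mul1r lerDl.
Qed.

Let ext_linr h : linear (ext h).
Proof.
move=> c x y; apply/eqP; rewrite -subr_eq0; apply/eqP.
apply: (@small0 _ _ (`|c *: x + y| + `|c| * `|x| + `|y|)).
  by rewrite !addr_ge0 // mulr_ge0.
move=> e e0; have [s /ltW hs] := gsum_dense h e0.
have -> : ext h (c *: x + y) - (c *: ext h x + ext h y) =
    (ext h (c *: x + y) - usum s (c *: x + y)) -
    c *: (ext h x - usum s x) - (ext h y - usum s y).
  rewrite usum_lin scalerBr -[RHS]addrA -opprD addrACA -opprD opprB.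
  by rewrite addrA subrK.
have eh z : `|ext h z - usum s z| <= `|z| * e.
  by rewrite (le_trans (extP _ _ _)) // mulrC ler_wpM2l.
rewrite !mulrDl (le_trans (ler_normB _ _)) // lerD // (le_trans (ler_normB _ _)) //.
by rewrite lerD // normrZ -mulrA ler_wpM2l.
Qed.

Let ext_linl x : linear (ext^~ x).
Proof.
move=> c h k; apply/eqP; rewrite -subr_eq0; apply/eqP.
apply: (@small0 _ _ ((1 + `|c|) * `|x| + `|c| * `|x| + `|x|)).
  by rewrite !addr_ge0 // mulr_ge0 // addr_ge0.
move=> e e0; have [s /ltW hs] := gsum_dense h e0.
have [t /ltW kt] := gsum_dense k e0.
have -> : ext (c *: h + k) x - (c *: ext h x + ext k x) =
    (ext (c *: h + k) x - usum (sublc c t s) x) -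
    c *: (ext h x - usum s x) - (ext k x - usum t x).
  rewrite usum_sublc scalerBr -[RHS]addrA -opprD addrACA -opprD opprB.
  by rewrite [usum t x + _]addrC addrA subrK.
rewrite (mulrDl _ `|x|) (mulrDl _ (`|c| * `|x|)).
rewrite (le_trans (ler_normB _ _)) // lerD //; last first.
  by rewrite (le_trans (extP _ _ _)) // mulrC ler_wpM2l.
rewrite (le_trans (ler_normB _ _)) // lerD //; last first.
  rewrite normrZ -mulrA ler_wpM2l //.
  by rewrite (le_trans (extP _ _ _)) // mulrC ler_wpM2l.
rewrite (le_trans (extP _ _ _)) // mulrAC ler_wpM2r //.
rewrite gsum_sublc opprD [- _ - _]addrC addrACA -scalerBr.
rewrite (le_trans (ler_normD _ _)) // mulrDl mul1r [leRHS]addrC lerD //.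
by rewrite normrZ ler_wpM2l.
Qed.

Let extM h k x : ext (h * k) x = ext h (ext k x).
Proof.
apply/eqP; rewrite -subr_eq0; apply/eqP; move: h.
apply: (@groupCStar_linear_eq0 _ (fun h => ext (h * k) x - ext h (ext k x))
   (2 * `|k| * `|x|)).
- move=> c h h' /=; rewrite mulrDl -scalerAl !ext_linl scalerBr opprD.
  by rewrite addrACA.
- move=> h; rewrite -!mulrA mulr_natl mulr2n (le_trans (ler_normB _ _)) //.
  rewrite lerD // (le_trans (ext_le _ _)) //.
    by rewrite [leRHS]mulrA [leRHS]mulrC [leRHS]mulrA ler_wpM2r // cstar_normM.
  by rewrite [leRHS]mulrA [leRHS]mulrC ler_wpM2l // ext_le.
(* The first density argument has made the left factor a group element; a second one now does the
   same for [k]. *)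
move=> g; rewrite ext_gcu; move: k.
apply: (@groupCStar_linear_eq0 _ (fun k => ext (gcu H g * k) x - U g (ext k x))
   (2 * `|gcu H g| * `|x|)).
- move=> c k k' /=; rewrite mulrDr -scalerAr !ext_linl linearP scalerBr opprD.
  by rewrite addrACA.
- move=> k; rewrite -ext_gcu -!mulrA mulr_natl mulr2n (le_trans (ler_normB _ _)) //.
  rewrite lerD // (le_trans (ext_le _ _)) //.
    by rewrite [`|x| * _]mulrC mulrA ler_wpM2r // cstar_normM.
  by rewrite ler_wpM2l // mulrC ext_le.
by move=> g'; rewrite -gcuM !ext_gcu urepM subrr.
Qed.

Let ext_star h x y : hdot K (ext h x) y = hdot K x (ext (star h) y).
Proof.
apply/eqP; rewrite -subr_eq0; apply/eqP; move: h.
apply: (@groupCStar_linear_eq0 R[i]^o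
   (fun h => hdot K (ext h x) y - hdot K x (ext (star h) y)) (2 * `|x| * `|y|)).
- move=> c h h' /=; rewrite starD starZ !ext_linl linearDl linearDr.
  rewrite linearZl_LR linearZr_LR /= conjCK.
  by rewrite opprD addrACA -mulrBr.
- move=> h /=; rewrite -!mulrA mulr_natl mulr2n (le_trans (ler_normB _ _)) //.
  rewrite lerD // (le_trans (hilbert_CauchySchwarz _ _)) //.
    by rewrite [leRHS]mulrA [leRHS]mulrC [leRHS]mulrA ler_wpM2r // ext_le.
  by rewrite ler_wpM2l // [leRHS]mulrC -(cstar_norm_starE h) ext_le.
move=> g /=; rewrite gcu_star !ext_gcu -(urep_dot U g x) -urepM mulgV urep_one.
exact: subrr.
Qed.

Let ext_linear h : {linear K -> K} :=
  HB.pack (ext h) (GRing.isLinear.Build R[i] K K _ (ext h) (ext_linr h)).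

(** Universal property of the full norm: by [gcu_norm] every unitary representation is dominated by
    the norm of [H], hence extends by continuity. *)
Lemma unitaryRep_extension : exists q : starRep H K, forall g x, q (gcu H g) x = U g x.
Proof.
have bounded h : exists M : R[i], forall x, `|ext_linear h x| <= M * `|x|.
  by exists `|h| => x; exact: ext_le.
have one x : ext_linear 1 x = x by rewrite /= -(gcu1 H) ext_gcu urep_one.
exists (@StarRep R H K ext_linear bounded ext_linl one extM ext_star) => g x.
exact: ext_gcu.
Qed.
End RepExtension.

(** * The counit *)

Section PermutationRep.
Variables (R : realType) (G : groupType) (I : finType) (act : G -> I -> I).
Hypothesis act1 : forall i, act 1%g i = i.
Hypothesis actM : forall g h i, act (g * h)%g i = act g (act h i).
Local Notation K := (l2_hilbert R I).

Definition perm_rep_fun (g : G) (f : K) : K :=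
  [ffun i => (f : {ffun I -> R[i]^o}) (act g^-1%g i)].

Let perm_linear g : linear (perm_rep_fun g).
Proof. by move=> c f f'; apply/ffunP => i; rewrite !ffunE. Qed.

Let perm_one f : perm_rep_fun 1%g f = f.
Proof. by apply/ffunP => i; rewrite !ffunE invg1 act1. Qed.

Let permM g h f : perm_rep_fun (g * h)%g f = perm_rep_fun g (perm_rep_fun h f).
Proof. by apply/ffunP => i; rewrite !ffunE invgM actM. Qed.

Let perm_dot g (f f' : K) : hdot K (perm_rep_fun g f) (perm_rep_fun g f') = hdot K f f'.
Proof.
have actK (h : G) : cancel (act h) (act h^-1%g).
  by move=> i; rewrite -actM mulVg act1.
rewrite /= /l2_dot [RHS](reindex (act g^-1%g)).
  by apply: eq_bigr => i _; rewrite !ffunE.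
by exists (act g) => i _; rewrite ?actK // -{1}[g]invgK actK.
Qed.

Definition perm_rep : unitaryRep G K := @UnitaryRep R G K
  (fun g => HB.pack (perm_rep_fun g)
     (GRing.isLinear.Build R[i] K K _ (perm_rep_fun g) (perm_linear g)))
  perm_one permM perm_dot.

Lemma perm_repE g (f : K) i :
  (perm_rep g f : {ffun I -> R[i]^o}) i = (f : {ffun I -> R[i]^o}) (act g^-1%g i).
Proof. by rewrite ffunE. Qed.

End PermutationRep.

(** The space is one-dimensional, being the functions on a single point; this representation is the
    source of the counit. *)
Definition trivial_rep (R : realType) (G : groupType) :
    unitaryRep G (l2_hilbert R unit) :=
  @perm_rep R G unit (fun _ => id) (fun _ => erefl) (fun _ _ _ => erefl).

Lemma trivial_repE (R : realType) (G : groupType) (g : G) (f : l2_hilbert R unit) :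
  trivial_rep R G g f = f.
Proof. by apply/ffunP => i; rewrite ffunE. Qed.

(** * Density principles for group algebras and tensor products *)

Section Density.
Variable R : realType.

(** [P] plays the role of a closed linear subspace; the lemma serves to replace the legs of a simple
    tensor by group elements. *)
Lemma groupCStar_linear_ind (G : groupType) (H : groupCStar R G)
    (W : normedModType R[i]) (P : W -> Prop) (f : H -> W) (C : R[i]) :
  P 0 -> (forall (c : R[i]) x y, P x -> P y -> P (c *: x + y)) ->
  (forall x, (forall e : R[i], 0 < e -> exists2 y, P y & `|x - y| < e) -> P x) ->
  linear f -> (forall h, `|f h| <= C * `|h|) ->
  (forall g, P (f (gcu H g))) -> forall h, P (f h).
Proof.
move=> P0 Plin Pcl f_lin fC PG h; apply: Pcl => e e0.
have f0 : f 0 = 0 by exact: linear_at0.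
have fB x y : f (x - y) = f x - f y.
  by rewrite addrC -scaleN1r f_lin scaleN1r addrC.
have C0 : 0 <= C.
  have := le_trans (normr_ge0 _) (fC 1); rewrite pmulr_lge0 //.
  by rewrite cstar_norm1.
have C1 : 0 < C + 1 by rewrite ltr_wpDl.
have /closure_normP /(_ h _ (divr_gt0 e0 C1)) := gcu_dense H.
move=> [_ [s ->] hs]; exists (f (\sum_(p <- s) p.1 *: gcu H p.2)).
  elim: s {hs} => [|p s IH]; first by rewrite big_nil f0.
  by rewrite big_cons f_lin; exact: Plin.
rewrite -fB (le_lt_trans (fC _)) //.
apply: (@le_lt_trans _ _ ((C + 1) * `|h - \sum_(p <- s) p.1 *: gcu H p.2|)).
  by rewrite ler_wpM2r // lerDl.
by rewrite mulrC -ltr_pdivlMr.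
Qed.

Lemma minTensor_linear_eq0 (A B : cstarType R) (T : minTensor A B)
    (W : normedModType R[i]) (f : T -> W) (C : R[i]) :
  linear f -> (forall x, `|f x| <= C * `|x|) ->
  (forall a b, f (tinl T a * tinr T b) = 0) -> forall x, f x = 0.
Proof.
move=> f_lin fC fT; apply: (bounded_linear_dense_eq0 (tdense T) f_lin fC).
have f0 : f 0 = 0 by exact: linear_at0.
move=> _ [s ->]; elim: s => [|p s IH]; first by rewrite big_nil.
by rewrite big_cons -[X in f (X + _)]scale1r f_lin IH fT scaler0 addr0.
Qed.

Lemma starHom_group_ext (G : groupType) (H : groupCStar R G) (B : cstarType R)
    (f g : starHom H B) :
  (forall x, f (gcu H x) = g (gcu H x)) -> f =1 g.
Proof.
move=> fg h; apply/eqP; rewrite -subr_eq0; apply/eqP; move: h.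
apply: (@groupCStar_linear_eq0 R G H B (fun h => f h - g h) 2).
- by move=> c x y /=; rewrite (linearP f) (linearP g) scalerBr opprD addrACA.
- move=> h; rewrite mulr_natl mulr2n (le_trans (ler_normB _ _)) //.
  by rewrite lerD // starHom_norm_le.
by move=> x; rewrite fg subrr.
Qed.

Lemma starHom_tensor_ext (A B C : cstarType R) (T : minTensor A B)
    (f g : starHom T C) :
  (forall a, f (tinl T a) = g (tinl T a)) ->
  (forall b, f (tinr T b) = g (tinr T b)) -> f =1 g.
Proof.
move=> fgl fgr x; apply/eqP; rewrite -subr_eq0; apply/eqP; move: x.
apply: (@minTensor_linear_eq0 _ _ T C (fun h => f h - g h) 2).
- by move=> c x y /=; rewrite (linearP f) (linearP g) scalerBr opprD addrACA.
- move=> h; rewrite mulr_natl mulr2n (le_trans (ler_normB _ _)) //.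
  by rewrite lerD // starHom_norm_le.
by move=> a b; rewrite (rmorphM f) (rmorphM g) /= fgl fgr subrr.
Qed.

Program Definition comp_starHom (A B C : cstarType R) (g : starHom B C)
    (f : starHom A B) : starHom A C := @StarHom R A C (g \o f) _.
Next Obligation. by move=> A B C g f x /=; rewrite !starHom_star. Qed.

End Density.

(** * Slicing one leg of [H \otimes H] by the counit *)

Section TensorProjection.
Variables (R : realType) (G : groupType) (H : groupCStar R G) (HH : minTensor H H).
Variable b : bool.
Local Notation pr p := (if b then p.1 else p.2).

(** The graph of the slice map on combinations of tensors of group elements. It is a relation
    because one element may have several such expressions; uniqueness of the value comes from
    [Dnorm]. *)
Let D (x : HH) (x' : H) := exists s : seq (R[i] * (G * G)),
  x = \sum_(p <- s) p.1 *: (tinl HH (gcu H p.2.1) * tinr HH (gcu H p.2.2)) /\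
  x' = \sum_(p <- s) p.1 *: gcu H (pr p.2).

Let hsq_l (K L : hilbertType R) (xi : K) (s : seq (R[i] * L)) :
  hsq [seq (p.1 *: xi, p.2) | p <- s] = `|xi| ^+ 2 * `|\sum_(p <- s) p.1 *: p.2| ^+ 2.
Proof.
rewrite /hsq big_map -!hdotE linear_sumlz mulr_sumr; apply: eq_bigr => p _.
rewrite big_map linear_sumr mulr_sumr; apply: eq_bigr => p' _ /=.
by rewrite !linearZl_LR !linearZr_LR /= !mulrA; ring.
Qed.

Let hsq_r (K L : hilbertType R) (xi : L) (s : seq K) :
  hsq [seq (p, xi) | p <- s] = `|xi| ^+ 2 * `|\sum_(p <- s) p| ^+ 2.
Proof.
rewrite /hsq big_map -!hdotE linear_sumlz mulr_sumr; apply: eq_bigr => p _.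
rewrite big_map linear_sumr mulr_sumr; apply: eq_bigr => p' _ /=.
by rewrite mulrC.
Qed.

(** A unitary representation [U] on the kept leg is paired with the trivial representation on the
    other. On the tensor of [v] with the unit vector [xi] the pair acts as [U] of the sliced sum on
    [v], so the minimal norm of [x] bounds every [U], hence the full norm of [x']. *)
Let Dnorm x x' : D x x' -> `|x'| <= `|x|.
Proof.
move=> [s [-> ->]]; set M := leRHS; have M0 : 0 <= M by exact: normr_ge0.
pose s' := [seq (p.1, pr p.2) | p <- s].
have -> : \sum_(p <- s) p.1 *: gcu H (pr p.2) = \sum_(p <- s') p.1 *: gcu H p.2.
  by rewrite big_map.
apply/(gcu_norm H s' M0) => K U v; rewrite big_map /=.
have [q qU] := unitaryRep_extension H U.
have [p pT] := unitaryRep_extension H (trivial_rep R G).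
pose xi : l2_hilbert R unit := [ffun => 1].
have xi1 : `|xi| ^+ 2 = 1.
  by rewrite -hdotE /= /l2_dot (big_pred1 tt) ?ffunE ?conjC1 ?mulr1 // => -[].
pose t := [seq (x.1 *: gcu H x.2.1, gcu H x.2.2) | x <- s].
have tM : `|\sum_(x <- t) tinl HH x.1 * tinr HH x.2| <= M.
  rewrite big_map /M; under eq_bigr => y _ do rewrite linearZ -scalerAl.
  exact: lexx.
rewrite -(@ler_pXn2r _ 2) ?nnegrE ?mulr_ge0 // exprMn.
move/(tnorm HH t M0) : tM => tM; case: b; rewrite /=.
  have := tM _ _ q p [:: (v, xi)].
  have -> : [seq (q x.1 u.1, p x.2 u.2) | x <- t, u <- [:: (v, xi)]] =
      [seq (w, xi) | w <- [seq x.1 *: U x.2.1 v | x <- s]].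
    rewrite /allpairs_dep /t -!map_comp; elim: (s) => //= y s1 ->.
    by rewrite pT trivial_repE (GRing.scalable_linear (rep_linear q v)) qU.
  rewrite hsq_r big_map xi1 mul1r.
  by rewrite -[[:: (v, xi)]]/[seq (w, xi) | w <- [:: v]] hsq_r big_seq1 xi1 mul1r.
have := tM _ _ p q [:: (xi, v)].
have -> : [seq (p x.1 u.1, q x.2 u.2) | x <- t, u <- [:: (xi, v)]] =
    [seq (x.1 *: xi, x.2) | x <- [seq (x.1, U x.2.2 v) | x <- s]].
  rewrite /allpairs_dep /t -!map_comp; elim: (s) => //= y s1 ->.
  by rewrite qU (GRing.scalable_linear (rep_linear p xi)) pT trivial_repE.
rewrite hsq_l big_map xi1 mul1r /=.
have -> : [:: (xi, v)] = [seq (x.1 *: xi, x.2) | x <- [:: (1, v)]].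
  by rewrite /= scale1r.
by rewrite hsq_l big_seq1 xi1 mul1r scale1r.
Qed.

Let Dlin (c : R[i]) x x' y y' :
  D x x' -> D y y' -> D (c *: x + y) (c *: x' + y').
Proof.
move=> [s [-> ->]] [t [-> ->]]; exists ([seq (c * p.1, p.2) | p <- s] ++ t).
by split; rewrite big_cat big_map scaler_sumr; congr (_ + _);
  apply: eq_bigr => p _; rewrite scalerA.
Qed.

Let D1 : D 1 1.
Proof.
exists [:: (1, (1%g, 1%g))]; rewrite !big_seq1 /= !gcu1 !rmorph1 mulr1 scale1r.
by split=> //; case: b; rewrite gcu1 scale1r.
Qed.

Let DM x x' y y' : D x x' -> D y y' -> D (x * y) (x' * y').
Proof.
move=> [s [-> ->]] [t [-> ->]].
exists [seq (p.1 * q.1, (p.2.1 * q.2.1, p.2.2 * q.2.2)%g) | p <- s, q <- t].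
split; rewrite big_allpairs_dep mulr_suml; apply: eq_bigr => p _;
  rewrite mulr_sumr; apply: eq_bigr => q _ /=;
  rewrite -scalerAl -scalerAr scalerA; congr (_ *: _).
  by rewrite !gcuM !rmorphM -!mulrA; congr (_ * _); rewrite !mulrA tcomm.
by case: b; rewrite gcuM.
Qed.

Let star_sum (V : cstarType R) (J : Type) (s : seq J) (F : J -> V) :
  star (\sum_(p <- s) F p) = \sum_(p <- s) star (F p).
Proof.
elim: s => [|p s IH]; last by rewrite !big_cons starD IH.
by rewrite !big_nil star0.
Qed.

Let Dstar x x' : D x x' -> D (star x) (star x').
Proof.
move=> [s [-> ->]].
exists [seq (Num.conj p.1, (p.2.1^-1, p.2.2^-1)%g) | p <- s].
split; rewrite big_map star_sum; apply: eq_bigr => p _; rewrite starZ;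
  congr (_ *: _) => /=.
  by rewrite starM -!starHom_star !gcu_star tcomm.
by rewrite gcu_star; case: b.
Qed.

(** [P] describes the closure of the domain, which is a closed subspace. Simple tensors span a dense
    subspace, and their left and then right legs are reduced to group elements. *)
Let Ddense : closure [set x | exists x', D x x'] = setT.
Proof.
pose S (x : HH) := exists x', D x x'.
pose P (x : HH) := forall e : R[i], 0 < e -> exists2 y, S y & `|x - y| < e.
have SP x : S x -> P x by move=> Sx e e0; exists x; rewrite ?subrr ?normr0.
have P0 : P 0.
  apply: SP; exists 0; exists [::]; by rewrite !big_nil.
have Plin (c : R[i]) x y : P x -> P y -> P (c *: x + y).
  move=> Px Py e e0; have c1 : 0 < `|c| + 1 by rewrite ltr_wpDl.
  have e1 : 0 < e / (`|c| + 1) by rewrite divr_gt0.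
  have [u [u' Du] xu] := Px _ e1; have [v [v' Dv] yv] := Py _ e1.
  exists (c *: u + v); first by exists (c *: u' + v'); exact: Dlin.
  rewrite opprD addrACA -scalerBr (le_lt_trans (ler_normD _ _)) // normrZ.
  apply: (@le_lt_trans _ _ (`|c| * (e / (`|c| + 1)) + `|y - v|)).
    by rewrite lerD2r ler_wpM2l // ltW.
  rewrite [ltRHS](_ : e = `|c| * (e / (`|c| + 1)) + e / (`|c| + 1)).
    by rewrite ltrD2l.
  by rewrite -{2}[e / _]mul1r -mulrDl mulrCA divff ?mulr1 ?gt_eqF.
have Pcl x : (forall e : R[i], 0 < e -> exists2 y, P y & `|x - y| < e) -> P x.
  move=> Px e e0; have e2 : 0 < e / 2 by rewrite divr_gt0.
  have [y Py xy] := Px _ e2; have [z Sz yz] := Py _ e2.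
  exists z => //; rewrite (le_lt_trans (ler_distD y _ _)) // [ltRHS]splitr.
  exact: ltrD.
apply/closure_normP => x; rewrite -/(P x); apply: (Pcl) => e e0.
have /closure_normP /(_ x e e0) [_ [s ->] xs] := tdense HH.
exists (\sum_(p <- s) tinl HH p.1 * tinr HH p.2) => // {xs}.
elim: s => [|[h h'] s IH]; first by rewrite big_nil.
rewrite big_cons -[X in X + _]scale1r; apply: (Plin) => //= {s IH}.
move: h; apply: (@groupCStar_linear_ind R G H HH P (fun h => tinl HH h * tinr HH h')
   `|tinr HH h'| P0 Plin Pcl).
- by move=> c x' y /=; rewrite (linearP (tinl HH)) mulrDl scalerAl.
- move=> h; rewrite mulrC (le_trans (cstar_normM _ _)) // ler_wpM2r //.
  exact: starHom_norm_le.
move=> g; move: h'; apply: (@groupCStar_linear_ind R G H HH P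
   (fun h' => tinl HH (gcu H g) * tinr HH h') `|tinl HH (gcu H g)| P0 Plin Pcl).
- by move=> c x' y /=; rewrite (linearP (tinr HH)) mulrDr scalerAr.
- move=> h; rewrite (le_trans (cstar_normM _ _)) // ler_wpM2l //.
  exact: starHom_norm_le.
move=> g'; apply: SP; exists (gcu H (pr (g, g'))); exists [:: (1, (g, g'))].
by rewrite !big_seq1 !scale1r.
Qed.

(* [id \otimes counit] if [b], [counit \otimes id] otherwise. *)
Lemma counit_tensor_exists : exists E : starHom HH H, forall g g' : G,
  E (tinl HH (gcu H g) * tinr HH (gcu H g')) = gcu H (if b then g else g').
Proof.
have [F FD] := starHom_extension D1 Dlin DM Dstar Dnorm Ddense.
exists F => g g'; apply: FD; exists [:: (1, (g, g'))].
by rewrite !big_seq1 !scale1r.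
Qed.

End TensorProjection.

(** * Nontriviality of the lattice *)

Section ModTwoRep.
Variables (n : nat) (sigma : SLZ n).
Local Notation Gamma := (Gamma sigma).
Local Notation V := 'rV['F_2]_n.

Let red (m : 'rV[int]_n) : V := map_mx intr m.
Let lift (x : V) : 'rV[int]_n := map_mx (fun a : 'F_2 => Posz a) x.

Let redK x : red (lift x) = x.
Proof. by apply/rowP => i; rewrite !mxE; exact: natr_Zp. Qed.

Let red_pow k m m' : red m = red m' ->
  red (dual_aut_pow sigma k m) = red (dual_aut_pow sigma k m').
Proof.
have red_iter (M : 'M[int]_n) j : red m = red m' ->
    red (iter j (mulmx^~ M) m) = red (iter j (mulmx^~ M) m').
  move=> mm'; elim: j => //= j IH.
  by rewrite /red !map_mxM; congr (_ *m _).
by case: k => j; exact: red_iter.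
Qed.

(** The affine action [x |-> m + x sigma^k] on [(Z / 2)^n], computed on an integer lift of [x]; by
    [red_pow] the result does not depend on the lift. *)
Definition mod2_act (g : Gamma) (x : V) : V :=
  red (g.1 + dual_aut_pow sigma g.2 (lift x)).

Let act1 x : mod2_act 1%g x = x.
Proof. by rewrite /mod2_act /= add0r redK. Qed.

Let redD m m' : red (m + m') = red m + red m'.
Proof. exact: map_mxD. Qed.

Let actM g h x : mod2_act (g * h)%g x = mod2_act g (mod2_act h x).
Proof.
rewrite /mod2_act /= -addrA [LHS]redD [RHS]redD; congr (_ + _).
rewrite dual_aut_powD -dual_aut_powDr; apply: red_pow.
by rewrite redK.
Qed.

Definition mod2_rep (R : realType) : unitaryRep Gamma (l2_hilbert R V) :=
  perm_rep R act1 actM.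

Lemma mod2_rep_neq (R : realType) (i : 'I_n) :
  exists f, mod2_rep R (delta_mx 0 i, 0) f != f.
Proof.
(* The indicator of [0] is moved to the indicator of the [i]-th basis vector, so the two differ at
   [0]. *)
exists [ffun x : V => (x == 0)%:R]; apply/eqP => /ffunP /(_ 0).
rewrite perm_repE !ffunE eqxx /mod2_act /=.
have -> : lift 0 = 0 by apply/rowP => j; rewrite !mxE.
rewrite addr0; case: eqP => [|_ /eqP]; last by rewrite eq_sym oner_eq0.
by move=> /rowP /(_ i); rewrite !mxE !eqxx.
Qed.

End ModTwoRep.

(* Since [tens AH] is nonzero, [tnorm] gives a nonzero representation of [A]. *)
Lemma tensor_rep_exists (R : realType) (A B : cstarType R) (T : minTensor A B) :
  exists (K : hilbertType R) (p : starRep A K) (x : K), x != 0.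
Proof.
apply: contrapT => no_rep.
have : `|1 : T| <= 0.
  have -> : 1 = \sum_(p <- [:: (1, 1)]) tinl T p.1 * tinr T p.2 :> T.
    by rewrite big_seq1 !rmorph1 mulr1.
  apply/tnorm => // K L p q eta; rewrite expr0n mul0r /hsq.
  have K0 x : x = 0 :> K.
    by apply: contrapT => /eqP x0; apply: no_rep; exists K, p, x.
  rewrite big1 // => u _; rewrite big1 // => v _.
  by rewrite (K0 u.1) linear0l mul0r.
by rewrite cstar_norm1 ler10.
Qed.

(** The zero norm is tested on the simple tensor of [y] with a nonzero vector [x] of a
    representation of [A], which gives [|x| ^+ 2 * |q b y| ^+ 2 <= 0]. *)
Lemma tinr_rep_eq0 (R : realType) (A B : cstarType R) (T : minTensor A B) (b : B)
    (L : hilbertType R) (q : starRep B L) (y : L) :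
  tinr T b = 0 -> q b y = 0.
Proof.
move=> b0; have [K [p [x x0]]] := tensor_rep_exists T.
have : `|tinr T b| <= 0 by rewrite b0 normr0.
have -> : tinr T b = \sum_(p <- [:: (1, b)]) tinl T p.1 * tinr T p.2.
  by rewrite big_seq1 rmorph1 mul1r.
move/tnorm => /(_ (lexx 0) K L p q [:: (x, y)]).
rewrite expr0n mul0r /hsq /= !big_seq1 /= rep_one !hdotE.
have x2 : 0 < `|x| ^+ 2 by rewrite exprn_gt0 // normr_gt0.
rewrite pmulr_rle0 // => h; apply/normr0_eq0/eqP.
by rewrite -sqrf_eq0 eq_le h exprn_ge0.
Qed.

Lemma tinr_gcu_neq1 (R : realType) (n : nat) (sigma : SLZ n)
    (H : groupCStar R (Gamma sigma)) (A : cstarType R) (AH : minTensor A H)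
    (i : 'I_n) :
  tinr AH (gcu H (delta_mx 0 i, 0)) <> 1.
Proof.
move=> g1; have [f /eqP] := mod2_rep_neq sigma R i; apply.
have [q qU] := unitaryRep_extension H (mod2_rep sigma R).
have := @tinr_rep_eq0 _ _ _ AH (gcu H (delta_mx 0 i, 0) - 1) _ q f.
rewrite rmorphB rmorph1 /= g1 subrr => /(_ erefl).
rewrite (GRing.zmod_morphism_linear (rep_linear q f)) qU rep_one => /eqP.
by rewrite subr_eq0 => /eqP.
Qed.

(** * Expansivity *)

Section Expansive.
Variables (R : realType) (B : cstarType R) (n' : nat).
Local Notation n := n'.+1.
Variable S : 'M[int]_n.
Local Notation Sc := (map_mx intr S : 'M[R[i]]_n).
Hypothesis S_hyp : forall z : R[i], eigenvalue Sc z -> `|z| != 1.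
Implicit Types (v : 'rV[int]_n -> B) (T : B -> B).

Definition torus_rep v :=
  [/\ v 0 = 1, forall m m', v (m + m') = v m * v m' & forall m, `|v m| <= 1].

Definition torus_conj v T :=
  [/\ linear T, forall y, `|T y| = `|y| & forall m, T (v m) = v (m *m S)].

Definition torus_dist v : R[i] := \sum_(i < n) `|v (delta_mx 0 i) - 1|.

(** The first-order part of [m |-> v m - 1], extended to complex vectors so that the factors
    [Sc - z%:M] for complex eigenvalues [z] can act on its argument. *)
Let L v (w : 'rV[R[i]]_n) : B := \sum_i w 0 i *: (v (delta_mx 0 i) - 1).

Let L_lin v c w w' : L v (c *: w + w') = c *: L v w + L v w'.
Proof.
rewrite /L scaler_sumr -big_split; apply: eq_bigr => i _ /=.
by rewrite !mxE scalerDl scalerA.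
Qed.

Let L0 v : L v 0 = 0.
Proof. by rewrite /L big1 // => i _; rewrite mxE scale0r. Qed.

Let L_delta v i : L v (delta_mx 0 i) = v (delta_mx 0 i) - 1.
Proof.
rewrite /L (bigD1 i) //= mxE !eqxx scale1r big1 ?addr0 // => j ji.
by rewrite mxE eqxx (negPf ji) scale0r.
Qed.

Let dist_ge0 v : 0 <= torus_dist v.
Proof. by rewrite sumr_ge0. Qed.

Let row_int_ind (P : 'rV[int]_n -> Prop) :
  P 0 -> (forall i, P (delta_mx 0 i)) ->
  (forall m m', P m -> P m' -> P (m + m')) -> (forall m, P m -> P (- m)) ->
  forall m, P m.
Proof.
move=> P0 Pe PD PN m; rewrite [m]row_sum_delta.
elim/big_ind : _ => // i _.
have -> : m 0 i *: delta_mx 0 i = delta_mx 0 i *~ m 0 i :> 'rV[int]_n.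
  by rewrite -scaler_int intz.
elim: (m 0 i) => [|k IH|k IH]; first by rewrite mulr0z.
  by rewrite intS mulrzDr mulr1z; apply: PD.
by rewrite intS opprD mulrzDr mulrNz mulr1z; apply: PD => //; exact: PN.
Qed.

(* [v (m + m') - 1 - (v m - 1) - (v m' - 1) = (v m - 1) * (v m' - 1)] is quadratic
   in the distance to [1]. *)
Let linearize m : exists2 C : R[i], 0 <= C & forall v, torus_rep v ->
  `|v m - 1| <= C * torus_dist v /\
  `|v m - 1 - L v (map_mx intr m)| <= C * torus_dist v ^+ 2.
Proof.
elim/row_int_ind : m => [|i|m m' [C C0 HC] [C' C'0 HC']|m [C C0 HC]].
- exists 0 => // v [v0 _ _]; rewrite v0 subrr !mul0r.
  have -> : map_mx intr (0 : 'rV[int]_n) = 0 :> 'rV[R[i]]_n.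
    by apply/rowP => j; rewrite !mxE.
  by rewrite L0 subrr normr0.
- exists 1 => // v _.
  have -> : map_mx intr (delta_mx 0 i : 'rV[int]_n) = delta_mx 0 i :> 'rV[R[i]]_n.
    by apply/rowP => j; rewrite !mxE; case: (_ && _).
  rewrite L_delta subrr normr0 !mul1r exprn_ge0 //; split => //.
  by rewrite /torus_dist (bigD1 i) //= lerDl sumr_ge0.
- exists (C + C' + C * C').
    by rewrite !addr_ge0 // mulr_ge0.
  move=> v vok; have [v0 vD v1] := vok.
  have [a1 a2] := HC v vok; have [b1 b2] := HC' v vok.
  have dec : v (m + m') - 1 = (v m - 1) + (v m' - 1) + (v m - 1) * (v m' - 1).
    rewrite vD addrAC -{1}[v m - 1]mulr1 -mulrDr [1 + _]addrC subrK addrA.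
    by rewrite -{3}[v m']mul1r -mulrDl subrK.
  split.
    have -> : v (m + m') - 1 = v m * (v m' - 1) + (v m - 1).
      by rewrite vD mulrBr mulr1 addrA subrK.
    rewrite (le_trans (ler_normD _ _)) // addrC.
    rewrite -addrA mulrDl lerD // (le_trans (cstar_normM _ _)) //.
    rewrite (@le_trans _ _ (C' * torus_dist v)) //.
      by rewrite (le_trans _ b1) // ler_piMl.
    by rewrite ler_wpM2r // lerDl mulr_ge0.
  have -> : map_mx intr (m + m') = map_mx intr m + map_mx intr m' :> 'rV[R[i]]_n.
    exact: map_mxD.
  rewrite dec -[map_mx _ m]scale1r L_lin scale1r addrAC opprD addrACA.
  rewrite (mulrDl _ (C * C')) (mulrDl _ C') (le_trans (ler_normD _ _)) // lerD //.
    by rewrite (le_trans (ler_normD _ _)) // lerD.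
  rewrite (le_trans (cstar_normM _ _)) // expr2 mulrACA.
  exact: ler_pM.
- exists (C + C * C); first by rewrite addr_ge0 // mulr_ge0.
  move=> v vok; have [v0 vD v1] := vok; have [a1 a2] := HC v vok.
  (* [v (- m)] is a contraction inverting [v m], so the linear bound for [- m] holds with the same
     [C]; the product term in the second bound accounts for [C * C]. *)
  have dec : v (- m) - 1 = - (v (- m) * (v m - 1)).
    by rewrite mulrBr -vD addNr v0 mulr1 opprB.
  have nm : `|v (- m) - 1| <= C * torus_dist v.
    rewrite dec normrN (le_trans (cstar_normM _ _)) // (le_trans _ a1) //.
    exact: ler_piMl.
  split; first by rewrite (le_trans nm) // ler_wpM2r // lerDl mulr_ge0.
  have -> : map_mx intr (- m) = - map_mx intr m :> 'rV[R[i]]_n by exact: map_mxN.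
  have -> : v (- m) - 1 - L v (- map_mx intr m) =
      - (v m - 1 - L v (map_mx intr m)) - (v (- m) - 1) * (v m - 1).
    have -> : L v (- map_mx intr m) = - L v (map_mx intr m).
      by have := L_lin v (-1) (map_mx intr m) 0; rewrite addr0 L0 addr0 !scaleN1r.
    have -> : (v (- m) - 1) * (v m - 1) = - (v (- m) - 1) - (v m - 1).
      by rewrite mulrBl mul1r -[v (- m) * _]opprK -dec.
    move: (v (- m) - 1) (v m - 1) (L v _) => d a l.
    by rewrite opprK opprB opprD !opprK [d + a]addrC addrA subrK addrC.
  rewrite (mulrDl C) (le_trans (ler_normB _ _)) // normrN lerD //.
  rewrite (le_trans (cstar_normM _ _)) // expr2 mulrACA.
  exact: ler_pM.
Qed.

(** [T] sends [v e_i - 1] exactly to [v (row i S) - 1], and [linearize] replaces the latter by its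
    first-order part. The constant depends on [w] but not on [v] or [T]. *)
Let intertwine (w : 'rV[R[i]]_n) : exists2 C : R[i], 0 <= C &
  forall v T, torus_rep v -> torus_conj v T ->
  `|T (L v w) - L v (w *m Sc)| <= C * torus_dist v ^+ 2.
Proof.
have /choice[C HC] (i : 'I_n) : exists C : R[i], 0 <= C /\ forall v, torus_rep v ->
    `|v (row i S) - 1 - L v (row i Sc)| <= C * torus_dist v ^+ 2.
  have [C C0 HC] := linearize (row i S); exists C; split=> // v /HC[_].
  by rewrite map_row.
exists (\sum_i `|w 0 i| * C i).
  by rewrite sumr_ge0 // => i _; rewrite mulr_ge0 //; case: (HC i).
move=> v T vok [T_lin T_iso Tv]; have [v0 _ _] := vok.
have T0 : T 0 = 0 by exact: linear_at0.
have T_sum (F : 'I_n -> B) : T (\sum_i w 0 i *: F i) = \sum_i w 0 i *: T (F i).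
  elim: (index_enum _) => [|i s IH]; first by rewrite !big_nil.
  by rewrite !big_cons T_lin IH.
have L_sum (F : 'I_n -> 'rV_n) : L v (\sum_i w 0 i *: F i) = \sum_i w 0 i *: L v (F i).
  elim: (index_enum _) => [|i s IH]; first by rewrite !big_nil.
  by rewrite !big_cons L_lin IH.
rewrite mulmx_sum_row L_sum /L T_sum -sumrB mulr_suml.
apply: le_trans (ler_norm_sum _ _ _) _; apply: ler_sum => i _.
rewrite -scalerBr normrZ -mulrA ler_wpM2l //.
have -> : T (v (delta_mx 0 i) - 1) = v (row i S) - 1.
  have T1 : T 1 = 1 by rewrite -v0 Tv mul0mx.
  have := T_lin (-1) 1 (v (delta_mx 0 i)).
  by rewrite !scaleN1r T1 Tv rowE addrC [_ + v _]addrC.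
exact: (HC i).2.
Qed.

(** As [T] is an isometry, [T y - z *: y] has norm at least [|1 - |z|| * |y|]. With [y = L v w] this
    vector is [L v (w *m (Sc - z%:M))] up to a quadratic error, so each factor costs only division
    by [|1 - |z||], nonzero off the unit circle. *)
Let descend (r : seq R[i]) : (forall z, z \in r -> `|z| != 1) ->
  forall w : 'rV[R[i]]_n, exists2 C : R[i], 0 <= C &
  forall v T, torus_rep v -> torus_conj v T ->
  `|L v w| <= C * (`|L v (w *m \prod_(z <- r) (Sc - z%:M))| + torus_dist v ^+ 2).
Proof.
elim: r => [|z r IH] z1 w.
  exists 1 => // v T _ _; rewrite big_nil mulmx1 mul1r lerDl.
  by rewrite exprn_ge0.
have z1' : `|z| != 1 by apply: z1; rewrite mem_head.
have [|C C0 HC] := IH _ (w *m (Sc - z%:M)).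
  by move=> y yr; apply: z1; rewrite in_cons yr orbT.
have [C' C'0 HC'] := intertwine w.
have d0 : 0 < `|1 - `|z| | by rewrite normr_gt0 subr_eq0 eq_sym.
exists ((C + C') / `|1 - `|z| |).
  exact: divr_ge0 (addr_ge0 C0 C'0) (ltW d0).
move=> v T vok Tok; have [T_lin T_iso _] := Tok.
rewrite mulrAC ler_pdivlMr // mulrC.
apply: (@le_trans _ _ `|T (L v w) - z *: L v w|).
  rewrite -[X in _ * X]normr_id -normrM mulrBl mul1r -normrZ -{1}(T_iso (L v w)).
  exact: ler_dist_dist.
have -> : T (L v w) - z *: L v w =
    L v (w *m (Sc - z%:M)) + (T (L v w) - L v (w *m Sc)).
  have -> : w *m (Sc - z%:M) = (- z) *: w + w *m Sc.
    by rewrite mulmxBr mul_mx_scalar scaleNr addrC.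
  by rewrite L_lin scaleNr addrC -addrA subrKC addrC.
rewrite (le_trans (ler_normD _ _)) // mulrDl lerD //.
  by have := HC v T vok Tok; rewrite big_cons mulmxA.
by rewrite (le_trans (HC' v T vok Tok)) // ler_wpM2l // lerDr.
Qed.

(** [descend] is applied to the roots of the characteristic polynomial: Cayley-Hamilton kills the
    linear term and leaves a purely quadratic bound. The threshold is chosen before [v] and [T], so
    that it can serve a whole path. *)
Lemma hyperbolic_expansive : exists2 e : R[i], 0 < e &
  forall v T, torus_rep v -> torus_conj v T -> torus_dist v < e -> torus_dist v = 0.
Proof.
have [r Sr] := closed_field_poly_normal (char_poly Sc).
rewrite (monicP (char_poly_monic Sc)) scale1r in Sr.
have r_hyp z : z \in r -> `|z| != 1.
  by move=> zr; apply: S_hyp; rewrite eigenvalue_root_char Sr root_prod_XsubC.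
have prod0 : \prod_(z <- r) (Sc - z%:M) = 0.
  rewrite -(Cayley_Hamilton Sc) Sr rmorph_prod; apply: eq_bigr => z _.
  by rewrite rmorphB /= horner_mx_X horner_mx_C.
have /choice[C HC] (i : 'I_n) : exists C : R[i], 0 <= C /\
    forall v T, torus_rep v -> torus_conj v T ->
    `|v (delta_mx 0 i) - 1| <= C * torus_dist v ^+ 2.
  have [C C0 HC] := descend r_hyp (delta_mx 0 i); exists C; split=> // v T vok Tok.
  by have := HC v T vok Tok; rewrite prod0 mulmx0 L0 normr0 add0r L_delta.
have C0 : 0 <= \sum_i C i by rewrite sumr_ge0 // => i _; case: (HC i).
(* Below this threshold the factor gained from the quadratic bound is less than [1]; the added [1]
   keeps the inverse positive when all [C i] vanish. *)
exists (\sum_i C i + 1)^-1; first by rewrite invr_gt0 ltr_wpDl.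
move=> v T vok Tok; rewrite -[_^-1]mul1r ltr_pdivlMr ?ltr_wpDl // => d1.
have le_d : torus_dist v <= torus_dist v * (torus_dist v * \sum_i C i).
  rewrite mulrA mulrC -expr2 mulr_suml; apply: ler_sum => i _.
  exact: (HC i).2 Tok.
apply/eqP; apply: contraT => d0.
have dpos : 0 < torus_dist v by rewrite lt_def d0 dist_ge0.
move: le_d d1; rewrite ler_pMr // mulrDr mulr1 => le1 /lt_le_trans /(_ le1).
by rewrite gtrDl => /(lt_trans dpos); rewrite ltxx.
Qed.
End Expansive.

(** * Continuous paths whose norms have a gap *)

Lemma continuous_cstar_affine (R : realType) (X : topologicalType) (B : cstarType R)
    (F : X -> B) (c : B) : continuous F -> continuous (fun t => F t * c - 1).
Proof.
move=> Fc t0; apply/cvgrPdist_lt => e e0.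
have c1 : 0 < `|c| + 1 by rewrite ltr_wpDl.
have /cvgrPdist_lt /(_ _ (divr_gt0 e0 c1)) := Fc t0.
apply: filterS => t Ft.
rewrite opprB addrA subrK -mulrBl (le_lt_trans (cstar_normM _ _)) //.
apply: (@le_lt_trans _ _ (`|F t0 - F t| * (`|c| + 1))).
  by rewrite ler_wpM2l // lerDl.
by rewrite -ltr_pdivlMr.
Qed.

(** Norms take values in [R[i]]; the real part makes a real function of the sum, as the intermediate
    value theorem requires. *)
Lemma continuous_Re_sum_norm (R : realType) (X : topologicalType)
    (V : normedModType R[i]) (n : nat) (F : 'I_n -> X -> V) :
  (forall i, continuous (F i)) ->
  continuous (fun t => complex.Re (\sum_i `|F i t|)).
Proof.
move=> Fc t0; apply/cvgrPdist_lt => d d0.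
(* Dividing by [n.+1] makes the sum of [n] errors strictly less than [d], also when [n = 0]. *)
have d1 : 0 < (d / n.+1%:R)%:C%C by rewrite ltcR divr_gt0.
have near_all : \forall t \near t0, forall i, `|F i t0 - F i t| < (d / n.+1%:R)%:C%C.
  by apply: filter_forall => i; have /cvgrPdist_lt := Fc i t0; apply.
apply: filterS near_all => t Ht; rewrite -ltcR.
have sumE s : \sum_i `|F i s| = (complex.Re (\sum_i `|F i s|))%:C%C.
  have [r _ Xr] : exists2 r : R, 0 <= r & \sum_i `|F i s| = r%:C%C.
    by apply: ge0_complexE; rewrite sumr_ge0.
  by rewrite Xr.
set a := complex.Re _; set b := complex.Re _.
have -> : (`|a - b|)%:C%C = `|\sum_i `|F i t0| - \sum_i `|F i t| |.
  rewrite (sumE t0) (sumE t) -rmorphB -/a -/b normc_def /=.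
  by rewrite expr0n /= addr0 sqrtr_sqr.
rewrite -sumrB (le_lt_trans (ler_norm_sum _ _ _)) //.
apply: (@le_lt_trans _ _ (\sum_(i < n) (d / n.+1%:R)%:C%C)).
  by apply: ler_sum => i _; apply: le_trans (ler_dist_dist _ _) (ltW (Ht i)).
rewrite -rmorph_sum ltcR sumr_const card_ord -[_ *+ n]mulr_natr mulrAC.
rewrite ltr_pdivrMr ?ltr0n //.
by rewrite ltr_pM2l // ltr_nat.
Qed.

(** A nonzero sum at [1] would be at least [e], so the intermediate value [e / 2] would be attained
    at some point, where the gap forces the sum to be [0]. *)
Lemma path_norm_gap (R : realType) (V : normedModType R[i]) (n : nat)
    (F : 'I_n -> I01 R -> V) (e : R[i]) :
  (forall i, continuous (F i)) -> 0 < e ->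
  (forall t, \sum_i `|F i t| < e -> \sum_i `|F i t| = 0) ->
  \sum_i `|F i (I01_0 R)| = 0 -> \sum_i `|F i (I01_1 R)| = 0.
Proof.
move=> Fc e0 gap X0.
pose f t := complex.Re (\sum_i `|F i t|).
have fE t : \sum_i `|F i t| = (f t)%:C%C.
  have [r _ Xr] : exists2 r : R, 0 <= r & \sum_i `|F i t| = r%:C%C.
    by apply: ge0_complexE; rewrite sumr_ge0.
  by rewrite /f Xr.
have fc : continuous f by exact: continuous_Re_sum_norm.
(* Extension by [0] outside the interval; only continuity within [[0, 1]] matters. *)
pose g (x : R) : R := if insub x is Some t then f t else 0.
have gE (t : I01 R) : g (val t) = f t by rewrite /g valK.
have gc : {within `[0, 1], continuous g}.
  apply/subspace_sigL_continuousP; suff -> : sigL `[0, 1] g = f by [].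
  by apply/funext => t; exact: gE.
have [r _ er] := ge0_complexE (ltW e0).
have r0 : 0 < r by rewrite -ltcR -er.
apply/eqP/contraT => X1.
have rf1 : r <= f (I01_1 R).
  by rewrite -lecR -fE -er real_leNgt ?ger0_real ?sumr_ge0 ?ltW //;
    apply: contra X1 => /gap ->.
have f0 : f (I01_0 R) = 0 by apply: (@complexI R); rewrite -fE X0.
have r2 : r / 2 < r by rewrite ltr_pdivrMr // mulr_natr mulr2n ltrDl.
have [|c c01 gcr] := @IVT R g 0 1 (r / 2) (ler01) gc.
  have -> : g 0 = 0 by rewrite -[RHS]f0 -gE.
  have -> : g 1 = f (I01_1 R) by rewrite -gE.
  by rewrite ge_min le_max (divr_ge0 (ltW r0)) //= (le_trans (ltW r2) rf1) orbT.
have c01' : c \in (`[0 : R, 1]%classic : set R) by rewrite inE.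
have := gap (exist _ c c01' : I01 R).
rewrite !fE -gE /= gcr er ltcR => /(_ r2) /(@complexI R) /eqP.
by rewrite mulf_eq0 invr_eq0 pnatr_eq0 orbF gt_eqF.
Qed.

(** * The homotopy *)

Section Main.
Variables (R : realType) (n' : nat).
Local Notation n := n'.+1.
Variables (sigma : SLZ n) (sigma_hyp : hyperbolic R sigma).
Local Notation Gamma := (Gamma sigma).
Variables (H : groupCStar R Gamma) (HH : minTensor H H) (Delta : starHom H HH).
Hypothesis Delta_gcu : forall g : Gamma,
  Delta (gcu H g) = tinl HH (gcu H g) * tinr HH (gcu H g).
Variables (A : cstarType R) (AH : minTensor A H).
Variables (AH_H : minTensor AH H) (A_HH : minTensor A HH).
Variables (alpha : associator AH_H A_HH) (delta : starHom A AH).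
Hypothesis delta_coaction : coaction Delta alpha delta.
Variables (J : ncjoin delta) (JH : minTensor J H) (dJ : starHom J JH).
Hypothesis dJ_def : join_coaction Delta alpha dJ.
Variables (phi : starHom H J) (phi_equiv : equivariant Delta dJ phi).
Variable E : starHom HH H.
Hypothesis E_gcu : forall g g' : Gamma,
  E (tinl HH (gcu H g) * tinr HH (gcu H g')) = gcu H g'.

Let E_tinr g : E (tinr HH (gcu H g)) = gcu H g.
Proof. by have := E_gcu 1%g g; rewrite gcu1 rmorph1 mul1r. Qed.

Let E_tinl g : E (tinl HH (gcu H g)) = 1.
Proof. by have := E_gcu g 1%g; rewrite gcu1 rmorph1 mulr1. Qed.

Let E_Delta h : E (Delta h) = h.
Proof.
apply: (@starHom_group_ext _ _ H H (comp_starHom E Delta) (idHom H)) => g /=.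
by rewrite Delta_gcu E_gcu.
Qed.

Let id_E : starHom A_HH AH := tmap A_HH AH (idHom A) E.
Let id_Delta : starHom AH A_HH := tmap AH A_HH (idHom A) Delta.

Let id_E_Delta x : id_E (id_Delta x) = x.
Proof.
apply: (@starHom_tensor_ext _ _ _ _ AH (comp_starHom id_E id_Delta) (idHom AH)) => y /=.
  by rewrite /id_Delta tmapl /id_E tmapl.
by rewrite /id_Delta tmapr /id_E tmapr E_Delta.
Qed.

(* [id \otimes counit], seen as an endomorphism of [AH]. *)
Let slice : starHom AH AH := comp_starHom id_E (comp_starHom alpha (tinl AH_H)).

Let path (t : I01 R) (g : Gamma) : AH := jev J t (phi (gcu H g)).
Let coef (t : I01 R) (g : Gamma) : AH := slice (path t g).

(** Equivariance turns [dJ (phi g)] into [phi g \otimes g], so [id \otimes Delta] of [path t g] is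
    [path t g \otimes g]. Applying the counit to the middle leg gives back [path t g] on one side,
    because [E] inverts [Delta], and slices it on the other. *)
Let path_coef t g : path t g = coef t g * tinr AH (gcu H g).
Proof.
have := dJ_def t (phi (gcu H g)); rewrite phi_equiv Delta_gcu.
rewrite !rmorphM /= !(tmapl, tmapr) /= assocr => /(congr1 id_E).
by rewrite id_E_Delta rmorphM /= {2}/id_E tmapr E_tinr.
Qed.

Let path1 t : path t 1%g = 1.
Proof. by rewrite /path gcu1 !rmorph1. Qed.

Let pathM t g h : path t (g * h)%g = path t g * path t h.
Proof. by rewrite /path gcuM !rmorphM. Qed.

Let star_path t g : star (path t g) = path t g^-1%g.
Proof. by rewrite /path -!starHom_star gcu_star. Qed.

Let coef1 t : coef t 1%g = 1.
Proof. by rewrite /coef path1 rmorph1. Qed.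

Let coefM t g h : coef t (g * h)%g = coef t g * coef t h.
Proof. by rewrite /coef pathM rmorphM. Qed.

Let coefV t g : coef t g * coef t g^-1%g = 1.
Proof. by rewrite -coefM mulgV coef1. Qed.

Let coefVl t g : coef t g^-1%g * coef t g = 1.
Proof. by rewrite -coefM mulVg coef1. Qed.

Let norm_coef t g : `|coef t g| = 1.
Proof. by apply: isometry_norm; rewrite /coef -starHom_star star_path coefVl. Qed.

Let coef_path t g : coef t g = path t g * tinr AH (gcu H g^-1%g).
Proof. by rewrite path_coef -mulrA -rmorphM -gcuM mulgV gcu1 rmorph1 mulr1. Qed.

Let pathP g : [/\ continuous (path^~ g),
  exists h, path (I01_0 R) g = tinr AH h & exists a, path (I01_1 R) g = delta a].
Proof. by apply/jevP; exists (phi (gcu H g)). Qed.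

(** The counit followed by the inclusion of scalars. Scalars appear only as values of this map, and
    their centrality is proved by density. *)
Let counit_unit : starHom H AH :=
  comp_starHom (tinr AH) (comp_starHom E (tinl HH)).

Let counit_unit_gcu g : counit_unit (gcu H g) = 1.
Proof. by rewrite /= E_tinl rmorph1. Qed.

Let counit_unit_comm h y : counit_unit h * y = y * counit_unit h.
Proof.
apply/eqP; rewrite -subr_eq0; apply/eqP; move: h.
apply: (@groupCStar_linear_eq0 _ _ H AH
  (fun h => counit_unit h * y - y * counit_unit h) (2 * `|y|)).
- move=> c h h'; rewrite (linearP counit_unit) mulrDl mulrDr -scalerAl -scalerAr.
  by rewrite scalerBr opprD addrACA.
- move=> h; rewrite -mulrA mulr_natl mulr2n (le_trans (ler_normB _ _)) //.
  rewrite lerD // (le_trans (cstar_normM _ _)) ?ler_wpM2l ?starHom_norm_le //.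
  by rewrite mulrC ler_wpM2l ?starHom_norm_le.
by move=> g; rewrite counit_unit_gcu mul1r mulr1 subrr.
Qed.

Let slice_tinr h : slice (tinr AH h) = counit_unit h.
Proof. by rewrite /= assocm /id_E tmapr. Qed.

(** At [t = 0] the path lies in [C \otimes H], and slicing the leg [H] leaves a scalar. *)
Let coef0_comm g y : coef (I01_0 R) g * y = y * coef (I01_0 R) g.
Proof.
have [_ [h ph] _] := pathP g.
by rewrite /coef ph slice_tinr counit_unit_comm.
Qed.

(** * The normalised lattice representations along the path *)

Let tr (m : 'rV[int]_n) : Gamma := (m, 0).
Let gen : Gamma := (0, 1).

Let trD m m' : tr (m + m') = (tr m * tr m')%g.
Proof. by []. Qed.

Let trN m : tr (- m) = (tr m)^-1%g.
Proof. by []. Qed.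

Let tr_conj m : (gen * tr m)%g = (tr (m *m sigma) * gen)%g.
Proof. by congr (_, _); rewrite /= ?add0r ?addr0. Qed.

(** Dividing by the scalars [coef 0] makes the path start at the trivial representation, and
    centrality keeps it multiplicative. *)
Let v t m := coef t (tr m) * coef (I01_0 R) (tr (- m)).

Let v_rep t : torus_rep (v t).
Proof.
split=> [|m m'|m].
- by rewrite /v oppr0 !coef1 mulr1.
- rewrite /v opprD !trD !coefM -!mulrA; congr (_ * _).
  by rewrite !mulrA coef0_comm.
- by rewrite (le_trans (cstar_normM _ _)) // !norm_coef mulr1.
Qed.

Let coef_conj t m :
  coef t gen * coef t (tr m) * coef t gen^-1%g = coef t (tr (m *m sigma)).
Proof. by rewrite -coefM tr_conj coefM -mulrA coefV mulr1. Qed.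

Let v_conj t : torus_conj sigma (v t) (fun y => coef t gen * y * coef t gen^-1%g).
Proof.
split=> [c y z|y|m].
- by rewrite mulrDr mulrDl -scalerAr -scalerAl.
- have le_conj g z : `|coef t g * z * coef t g^-1%g| <= `|z|.
    rewrite (le_trans (cstar_normM _ _)) // norm_coef mulr1.
    by rewrite (le_trans (cstar_normM _ _)) // norm_coef mul1r.
  apply/le_anti; rewrite le_conj /=.
  have := le_conj gen^-1%g (coef t gen * y * coef t gen^-1%g).
  by rewrite invgK -!mulrA coefVl mulr1 mulrA coefVl mul1r.
- rewrite /v mulrA -mulrA coef0_comm mulrA coef_conj; congr (_ * _).
  (* The scalar factor must also be carried from [m] to [m *m sigma]: conjugation fixes
     [coef 0 (- m)] because it is central, so [coef 0] agrees on [- m] and its image. *)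
  have := coef_conj (I01_0 R) (- m).
  by rewrite coef0_comm -mulrA coefV mulr1 mulNmx.
Qed.

Let v1 i : v (I01_1 R) (delta_mx 0 i) = 1.
Proof.
have [e e0 gap] := hyperbolic_expansive AH sigma_hyp.
have := @path_norm_gap R AH n (fun i t => v t (delta_mx 0 i) - 1) e _ e0.
move=> H0; apply/eqP; rewrite -subr_eq0 -normr_eq0; apply/eqP.
apply: (psumr_eq0P _ (H0 _ _ _)) => // {H0 i}.
(* In [t], [v] is [path] times a constant, so its continuity comes from that of elements of the
   join. *)
- move=> i; have -> : (fun t => v t (delta_mx 0 i) - 1) = (fun t =>
    path t (tr (delta_mx 0 i)) * (tinr AH (gcu H (tr (delta_mx 0 i))^-1%g) *
      coef (I01_0 R) (tr (- delta_mx 0 i))) - 1).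
    by apply/funext => t; rewrite /v coef_path mulrA.
  by apply: continuous_cstar_affine; have [] := pathP (tr (delta_mx 0 i)).
- by move=> t; apply: gap (v_rep t) (v_conj t).
- by rewrite big1 // => i _; rewrite /v trN coefV subrr normr0.
Qed.

Lemma no_equivariant_starHom : False.
Proof.
pose g := tr (delta_mx 0 (ord0 : 'I_n)).
have [_ [h p0] _] := pathP g; have [_ _ [a p1]] := pathP g.
have c1 : coef (I01_1 R) g = counit_unit h.
  rewrite -slice_tinr -p0 -[LHS]mulr1 -(coefVl (I01_0 R) g) mulrA -/(coef _ _).
  by have := v1 ord0; rewrite /v -/g trN => ->; rewrite mul1r.
have delta_a : delta a = counit_unit h * tinr AH (gcu H g) by rewrite -p1 path_coef c1.
have [_ /(_ a) + _] := delta_coaction.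
(* With [lambda] the scalar [counit_unit h], the two sides of the coaction identity become
   [lambda (1 \otimes 1 \otimes g)] and [lambda (1 \otimes g \otimes g)]. *)
rewrite delta_a !rmorphM /= !tmapr /= !assocr Delta_gcu.
have DE : Delta (E (tinl HH h)) = tinr HH (E (tinl HH h)).
  apply: (@starHom_group_ext _ _ H HH (comp_starHom Delta (comp_starHom E (tinl HH)))
    (comp_starHom (tinr HH) (comp_starHom E (tinl HH)))) => x /=.
  by rewrite E_tinl !rmorph1.
(* [w] is the inverse of [lambda] inside [A_HH]; multiplying by it and by the inverse of the last
   leg leaves [1 = 1 \otimes g \otimes 1]. *)
pose w := id_Delta (coef (I01_1 R) g^-1%g).
have wz : w * tinr A_HH (tinr HH (E (tinl HH h))) = 1.
  have := coefVl (I01_1 R) g; rewrite c1 => /(congr1 id_Delta).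
  by rewrite rmorphM rmorph1 /= {2}/id_Delta tmapr DE.
rewrite DE => /(congr1 (fun x => w * x * tinr A_HH (tinr HH (gcu H g^-1%g)))).
have gV : tinr A_HH (tinr HH (gcu H g)) * tinr A_HH (tinr HH (gcu H g^-1%g)) = 1.
  by rewrite -rmorphM -(rmorphM (tinr HH)) -gcuM mulgV gcu1 !rmorph1.
rewrite !mulrA wz !mul1r gV (rmorphM (tinr A_HH)) /= -mulrA gV mulr1.
(* The counit on the last leg brings this identity back to [AH], where it says that [1 \otimes g] is
   the unit. *)
have [E' E'_gcu] := counit_tensor_exists HH true.
move=> /(congr1 (tmap A_HH AH (idHom A) E')); rewrite rmorph1 tmapr.
have -> : E' (tinl HH (gcu H g)) = gcu H g.
  by have := E'_gcu g 1%g; rewrite gcu1 rmorph1 mulr1.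
by move=> /esym; exact: tinr_gcu_neq1.
Qed.
End Main.

Theorem theorem2p10 (R : realType) (n : nat) (n_ge2 : (2 <= n)%N)
    (sigma : SLZ n) (sigma_hyp : hyperbolic R sigma)
    (H : groupCStar R (Gamma sigma)) (HH : minTensor H H)
    (Delta : starHom H HH)
    (Delta_gcu : forall g : Gamma sigma,
       Delta (gcu H g) = tinl HH (gcu H g) * tinr HH (gcu H g))
    (A : cstarType R) (AH : minTensor A H)
    (AH_H : minTensor AH H) (A_HH : minTensor A HH)
    (alpha : associator AH_H A_HH)
    (delta : starHom A AH)
    (delta_coaction : coaction Delta alpha delta)
    (delta_free : free_coaction delta)
    (J : ncjoin delta) (JH : minTensor J H) (dJ : starHom J JH)
    (dJ_def : join_coaction Delta alpha dJ) :
  ~ exists phi : starHom H J, equivariant Delta dJ phi.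
Proof.
destruct n as [|n']; first by [].
move=> [phi phi_equiv]; have [E E_gcu] := counit_tensor_exists HH false.
exact: (no_equivariant_starHom sigma_hyp Delta_gcu delta_coaction dJ_def
  phi_equiv E_gcu).
Qed.
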